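(* Let $S$ be a compact, connected, non-positively curved special cube complex, $\Gamma$ its fundamental group, $X$ its universal covering (a CAT(0) cube complex), $\ell$ a $\Gamma$-invariant admissible edge labeling on $X$, and $o\in X^{(0)}$. Suppose that for every reduced word $v\in\mathcal L_o^{cube}\setminus\{\epsilon\}$, every label-morphism $\sigma:\Sigma_{0,v}\to\Sigma_0$ that is compatible with $v$ also appears at $v$ in $G_o$. Then there exists a finitely generated dense subgroup of $\mathrm{Aut}(X)$.
   Context: $\mathrm{Aut}(X)$ is the group of cubical automorphisms of $X$ with the compact-open topology; $G_o$ is the stabilizer of $o$ in $\mathrm{Aut}(X)$. ''Special'' is in the sense of Haglund--Wise (hyperplanes are embedded and two-sided, do not directly self-osculate, and do not inter-osculate). Labelings. $\vec{\mathcal E}(X)$ is the set of oriented edges, $\vec{\mathcal E}(X)_v$ those starting at $v$. Oriented edges are parallel if they cross the same hyperplane in the same direction. Two edges with exactly one common endpoint span a square if they are two sides of a common square. An admissible edge labeling is a map $\ell:\vec{\mathcal E}(X)\to\Sigma_0$ to a finite set $\Sigma_0$ with fixpoint-free involution $s\mapsto s^{-1}$ such that: (A1) parallel oriented edges have equal labels and reversing orientation inverts the label; (A2) $\ell|_{\vec{\mathcal E}(X)_v}$ is injective for each vertex $v$; (A3) if $e_1,e_2\in\vec{\mathcal E}(X)_v$, $e_1',e_2'\in\vec{\mathcal E}(X)_w$ with $\ell(e_i)=\ell(e_i')$ for $i=1,2$, then $e_1,e_2$ span a square iff $e_1',e_2'$ do. It is $\Gamma$-invariant if $\ell(g(e))=\ell(e)$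 for all $g\in\Gamma$ and all $e$. Labels and words. $\Sigma_{0,v}=\ell(\vec{\mathcal E}(X)_v)$. Labels $s,t\in\Sigma_0$ commute, $[s,t]=1$, if at some vertex there are outgoing edges labeled $s$ and $t$ spanning a square; otherwise $[s,t]\ne1$. $\Sigma$ is the set of nonempty subsets of $\Sigma_0$ whose distinct elements commute pairwise; $s\in\Sigma_0$ is identified with $\{s\}$. An oriented diagonal is an ordered pair of opposite vertices $(v,w)$ of a cube $C$ of dimension $\ge1$; its label is the set of labels of the edges of $C$ starting at $v$. $\Sigma_v\subset\Sigma$ is the set of labels of oriented diagonals starting at $v$. For $\alpha,\beta\in\Sigma_v$, $[\alpha,\beta]=1$ means every $s\in\alpha$ commutes with every $t\in\beta$. A cube path is a finite concatenation of oriented diagonals; its word is the sequence of labels. $\mathcal L_o^{cube}\subset\Sigma^*$ is the set of words of cube paths starting at $o$ (each word determines its path); $\epsilon$ is the empty word. A word $v\in\mathcal L_o^{cube}$ is also used to denote the endpoint of its path, and $\Sigma_v,\Sigma_{0,v}$ refer to this endpoint. A word is reduced if its path crosses no hyperplane more than once, reducible otherwise. Label-morphism: an injective map $\sigma:\Sigma_{0,v}\to\Sigma_0$ with $[s,t]=1\Leftrightarrow[\sigma(s),\sigma(t)]=1$ for all $s,t\in\Sigma_{0,v}$, extended to $\Sigma_v$ by $\sigma(\{s_1,\dots,s_n\})=\{\sigma(s_1),\dots,\sigma(s_n)\}$. The notation $\sigma(\alpha)=\alpha$ means $\sigma(s)=s$ for every $s\in\alpha$. Compatible: for a reduced word $v\neq\epsilon$,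 $\sigma$ is compatible with $v$ if for every $\alpha\in\Sigma_v$ such that $v\alpha$ is reducible we have $\sigma(\alpha)=\alpha$, and moreover $\sigma(\beta)=\beta$ for every $\beta\in\Sigma_v$ with $[\alpha,\beta]=1$. Portrait: for $g\in G_o$ and a vertex $v$, ${}_{v}\sigma(g):\Sigma_v\to\Sigma_{g(v)}$ sends the label of an outgoing diagonal $d$ at $v$ to the label of $g(d)$. Types: for a vertex $v\ne o$ let $\hat h_1,\dots,\hat h_n$ be the hyperplanes that intersect an edge incident to $v$ and separate $o$ from $v$, and $h_i$ the halfspace of $\hat h_i$ containing $v$. A vertex $w$ is of Type 1 relative to $(o,v)$ if $w\notin h_1\cap\dots\cap h_n$; of Type 2 if $w\in h_1\cap\dots\cap h_n$ and $w$ lies in the carrier of some $\hat h_i$ (the union of cubes meeting $\hat h_i$); of Type 3 otherwise. Appears: for $v\neq o$, a label-morphism $\sigma:\Sigma_{0,v}\to\Sigma_0$ appears at $v$ in $G_o$ if there is $g\in G_o$ with ${}_{v}\sigma(g)=\sigma$ which fixes all vertices of Type 1 and Type 2 relative to $(o,v)$. *)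

(* Defs.v *)
From HB Require Import structures.
From Stdlib Require Import Relation_Operators.
From mathcomp Require Import all_boot all_order all_algebra.
From mathcomp Require Import monoid generic_quotient.
From mathcomp Require Import all_classical all_reals all_analysis.

Set Implicit Arguments.
Unset Strict Implicit.
Unset Printing Implicit Defensive.

Import Order.TTheory GRing.Theory Num.Theory.
Import numFieldNormedType.Exports.
Local Open Scope classical_set_scope.

(* [face m n] : the isometric embeddings of [0,1]^m onto an m-dimensional face
   of [0,1]^n.  Such an embedding is determined by the image [base] of the
   corner (0,...,0) and by the direction [dir k] in which it sends the k-th
   axis; the i-th coordinate is reflected when [base i] is true. *)
Record face (m n : nat) := Face {
  dir : {ffun 'I_m -> 'I_n};
  base : {ffun 'I_n -> bool};
  dir_inj : injectiveb dir }.

Definition place (T : Type) (z : T) m n (f : face m n) (x : 'I_m -> T)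
    (i : 'I_n) : T :=
  oapp x z [pick k | dir f k == i].

Definition face_vertex m n (f : face m n) (x : {ffun 'I_m -> bool}) :
    {ffun 'I_n -> bool} :=
  [ffun i => base f i (+) place false f x i].

Lemma idface_inj n : injectiveb [ffun i : 'I_n => i].
Proof. by apply/injectiveP => i j; rewrite !ffunE. Qed.

Definition idface n : face n n := Face [ffun=> false] (idface_inj n).

Lemma compface_inj m n k (f : face n k) (g : face m n) :
  injectiveb [ffun i => dir f (dir g i)].
Proof.
apply/injectiveP => i j; rewrite !ffunE.
by move=> /(injectiveP _ (dir_inj f)) /(injectiveP _ (dir_inj g)).
Qed.

Definition compface m n k (f : face n k) (g : face m n) : face m k :=
  Face (face_vertex f (base g)) (compface_inj f g).

Lemma vertface_inj n : injectiveb (ffun0 (card_ord 0) : {ffun 'I_0 -> 'I_n}).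
Proof. by apply/injectiveP => -[]. Qed.

Definition vertface n (b : {ffun 'I_n -> bool}) : face 0 n :=
  Face b (vertface_inj n).

Lemma edgeface_inj n (i : 'I_n) : injectiveb [ffun _ : 'I_1 => i].
Proof. by apply/injectiveP => j k _; rewrite !ord1. Qed.

(* The edge of [0,1]^n through the vertex b in direction i, starting at b. *)
Definition edgeface n (i : 'I_n) (b : {ffun 'I_n -> bool}) : face 1 n :=
  Face b (edgeface_inj i).

Definition b0 n : {ffun 'I_n -> bool} := [ffun=> false].
Definition b1 n : {ffun 'I_n -> bool} := [ffun=> true].

(* A cube complex obtained by gluing unit cubes along isometries of their
   faces.  [cell n] is the set of parametrised n-cubes, i.e. characteristic
   maps [0,1]^n -> K precomposed with all isometries of [0,1]^n, and
   [restr f c] is the restriction of c along the face embedding f.  Thus a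
   geometric n-cube is an orbit of the symmetry group of [0,1]^n; [restr_free]
   says that no cube is glued to itself by a nontrivial symmetry.  Distinct
   faces of one cube may be identified, and several cubes may have the same
   boundary.  In dimension 1, [cell 1] is the set of oriented edges. *)
Record cubeComplex := CubeComplex {
  cell :> nat -> choiceType;
  restr : forall m n, face m n -> cell n -> cell m;
  restr_id : forall n (c : cell n), restr (idface n) c = c;
  restr_comp : forall m n k (f : face n k) (g : face m n) (c : cell k),
    restr (compface f g) c = restr g (restr f c);
  restr_free : forall n (f g : face n n) (c : cell n),
    restr f c = restr g c -> f = g }.

Section Cells.
Context {K : cubeComplex}.

Definition cvert n (b : {ffun 'I_n -> bool}) (c : K n) : K 0 :=
  restr (vertface b) c.
Definition cedge n (i : 'I_n) (b : {ffun 'I_n -> bool}) (c : K n) : K 1 :=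
  restr (edgeface i b) c.

Definition start n (c : K n) : K 0 := cvert (b0 n) c.
Definition finish n (c : K n) : K 0 := cvert (b1 n) c.
Definition rev_edge (e : K 1) : K 1 := cedge ord0 (b1 1) e.

(* The oriented edges of c starting at [start c]. *)
Definition corner n (c : K n) (i : 'I_n) : K 1 := cedge i (b0 n) c.

Definition square_corner (e f : K 1) : Prop :=
  exists c : K 2, corner c ord0 = e /\ corner c ord_max = f.

(* Links are flag simplicial complexes.  The simplices of the link of v are
   the corners at v of the cubes of K, i.e. the parametrised cubes starting at
   v up to permutation of the coordinates; the vertices of such a simplex are
   the oriented edges [corner c i]. *)
Definition simplicial_links : Prop :=
  (forall n (c : K n), injective (corner c)) /\
  (forall n (c d : K n), start c = start d -> corner c =1 corner d -> c = d).

Definition flag_links : Prop :=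
  forall (v : K 0) n (e : 'I_n -> K 1),
    injective e -> (forall i, start (e i) = v) ->
    (forall i j, i != j -> square_corner (e i) (e j)) ->
    exists c : K n, start c = v /\ corner c =1 e.

Definition nonpositively_curved : Prop := simplicial_links /\ flag_links.

Definition opposite_in_square (e f : K 1) : Prop :=
  exists (c : K 2) (i : 'I_2) (b b' : {ffun 'I_2 -> bool}),
    [/\ b i = b' i, e = cedge i b c & f = cedge i b' c].

(* Oriented edges crossing the same hyperplane in the same direction. *)
Definition parallel : K 1 -> K 1 -> Prop :=
  clos_refl_sym_trans (K 1) opposite_in_square.

(* A hyperplane is represented by any of the oriented edges dual to it. *)
Definition same_hyperplane (e f : K 1) : Prop :=
  parallel e f \/ parallel e (rev_edge f).

Definition self_intersects (h : K 1) : Prop :=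
  exists e f, [/\ same_hyperplane h e, same_hyperplane h f & square_corner e f].

Definition one_sided (h : K 1) : Prop := parallel h (rev_edge h).

Definition directly_self_osculates (h : K 1) : Prop :=
  exists e f, [/\ parallel h e, parallel h f, start e = start f, e <> f
                & ~ square_corner e f].

Definition intersect (h k : K 1) : Prop :=
  exists e f, [/\ same_hyperplane h e, same_hyperplane k f & square_corner e f].

Definition osculate (h k : K 1) : Prop :=
  exists e f, [/\ same_hyperplane h e, same_hyperplane k f, start e = start f,
                  e <> f & ~ square_corner e f].

Definition inter_osculate (h k : K 1) : Prop :=
  [/\ ~ same_hyperplane h k, intersect h k & osculate h k].

Definition special : Prop :=
  [/\ forall h, ~ self_intersects h, forall h, ~ one_sided h,
      forall h, ~ directly_self_osculates h
    & forall h k, ~ inter_osculate h k].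

Fixpoint edge_path (v : K 0) (p : seq (K 1)) (w : K 0) : Prop :=
  if p is e :: p' then start e = v /\ edge_path (finish e) p' w else v = w.

Variant elementary_homotopy : seq (K 1) -> seq (K 1) -> Prop :=
| HomotopyBacktrack p q e :
    elementary_homotopy (p ++ [:: e; rev_edge e] ++ q) (p ++ q)
| HomotopySquare p q (c : K 2) (b := [ffun i : 'I_2 => i == ord0])
    (b' := [ffun i : 'I_2 => i == ord_max]) :
    elementary_homotopy
      (p ++ [:: cedge ord0 (b0 2) c; cedge ord_max b c] ++ q)
      (p ++ [:: cedge ord_max (b0 2) c; cedge ord0 b' c] ++ q).

Definition homotopic (v w : K 0) : seq (K 1) -> seq (K 1) -> Prop :=
  clos_refl_sym_trans (seq (K 1)) (fun p q =>
    [/\ edge_path v p w, edge_path v q w & elementary_homotopy p q]).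

(* Connectedness and triviality of the edge-path group, which is the
   fundamental group of the geometric realization. *)
Definition simply_connected : Prop :=
  (forall v w, exists p, edge_path v p w) /\
  (forall v p, edge_path v p v -> homotopic v v p [::]).

Definition is_endpoint (v : K 0) (e : K 1) : Prop := v = start e \/ v = finish e.

Definition is_side (e : K 1) (c : K 2) : Prop := exists f : face 1 2, restr f c = e.

Definition span_square (e f : K 1) : Prop :=
  (exists! v, is_endpoint v e /\ is_endpoint v f) /\
  (exists c, is_side e c /\ is_side f c).

(* The set of vertices in the same component as v of the complement of the
   hyperplane dual to h. *)
Definition halfspace (h : K 1) (v : K 0) : set (K 0) :=
  [set w | exists2 p, edge_path v p w
                    & forall e, e \in p -> ~ same_hyperplane h e].

Definition separates (h : K 1) (v w : K 0) : Prop := ~ halfspace h v w.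

Definition carrier (h : K 1) : set (K 0) :=
  [set w | exists n (c : K n), (exists b, cvert b c = w) /\
                               (exists f : face 1 n, same_hyperplane h (restr f c))].

(* The hyperplane dual to the edge h, starting at v, is one of the
   hyperplanes adjacent to v that separate o from v. *)
Definition adjacent_separating (o v : K 0) (h : K 1) : Prop :=
  start h = v /\ separates h o v.

Definition type1 (o v w : K 0) : Prop :=
  ~ (forall h, adjacent_separating o v h -> halfspace h v w).

Definition type2 (o v w : K 0) : Prop :=
  (forall h, adjacent_separating o v h -> halfspace h v w) /\
  (exists2 h, adjacent_separating o v h & carrier h w).

End Cells.

Arguments nonpositively_curved : clear implicits.
Arguments special : clear implicits.
Arguments simply_connected : clear implicits.

Record cubeMap (K L : cubeComplex) := CubeMap {
  cmap :> forall n, K n -> L n;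
  cmap_restr : forall m n (f : face m n) (c : K n),
    cmap (restr f c) = restr f (cmap c) }.

Definition covering (K L : cubeComplex) (p : cubeMap K L) : Prop :=
  (forall w : L 0, exists v : K 0, p 0 v = w) /\
  (forall (v : K 0) n (c : L n), start c = p 0 v ->
    exists! d : K n, start d = v /\ p n d = c).

Definition universal_covering (K L : cubeComplex) (p : cubeMap K L) : Prop :=
  covering p /\ simply_connected K.

Definition idmap_cube (K : cubeComplex) : cubeMap K K :=
  @CubeMap K K (fun _ c => c) (fun _ _ _ _ => erefl).

Lemma compmap_restr (K L M : cubeComplex) (g : cubeMap L M) (h : cubeMap K L)
    m n (f : face m n) (c : K n) :
  g m (h m (restr f c)) = restr f (g n (h n c)).
Proof. by rewrite !cmap_restr. Qed.

Definition compmap (K L M : cubeComplex) (g : cubeMap L M) (h : cubeMap K L) :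
  cubeMap K M := CubeMap (compmap_restr g h).

Record aut (X : cubeComplex) := Aut {
  amap :> cubeMap X X;
  ainv : cubeMap X X;
  amapK : forall n, cancel (amap n) (ainv n);
  ainvK : forall n, cancel (ainv n) (amap n) }.

Section AutGroup.
Context {X : cubeComplex}.

Lemma cubeMap_eq (f g : cubeMap X X) : (forall n c, f n c = g n c) -> f = g.
Proof.
case: f g => [f fr] [g gr] /= fg.
have E : f = g by apply: functional_extensionality_dep => n; apply/funext => c.
by case: _ / E in gr *; congr CubeMap; exact: Prop_irrelevance.
Qed.

Lemma aut_eq (f g : aut X) : (forall n c, f n c = g n c) -> f = g.
Proof.
move=> fg; have gf n c : ainv f n c = ainv g n c.
  by rewrite -[in LHS](ainvK g c) -fg amapK.
case: f g fg gf => [f f' fK f'K] [g g' gK g'K] /= /cubeMap_eq fg /cubeMap_eq gf.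
case: _ / fg in gK g'K *; case: _ / gf in gK g'K *.
by congr Aut; exact: Prop_irrelevance.
Qed.

Definition aut1 : aut X :=
  @Aut X (idmap_cube X) (idmap_cube X) (fun _ _ => erefl) (fun _ _ => erefl).

Definition autV (g : aut X) : aut X := Aut (@ainvK X g) (@amapK X g).

Lemma autM_subproof (g h : aut X) n :
  cancel (compmap g h n) (compmap (ainv h) (ainv g) n).
Proof. by move=> c /=; rewrite !amapK. Qed.

Lemma autM_subproof' (g h : aut X) n :
  cancel (compmap (ainv h) (ainv g) n) (compmap g h n).
Proof. by move=> c /=; rewrite !ainvK. Qed.

Definition autM (g h : aut X) : aut X :=
  Aut (@autM_subproof g h) (@autM_subproof' g h).

Lemma autMA : associative autM. Proof. by move=> f g h; exact: aut_eq. Qed.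
Lemma aut1M : left_id aut1 autM. Proof. by move=> f; exact: aut_eq. Qed.
Lemma autM1 : right_id aut1 autM. Proof. by move=> f; exact: aut_eq. Qed.
Lemma autVM : left_inverse aut1 autV autM.
Proof. by move=> f; apply: aut_eq => n c /=; rewrite amapK. Qed.
Lemma autMV : right_inverse aut1 autV autM.
Proof. by move=> f; apply: aut_eq => n c /=; rewrite ainvK. Qed.

HB.instance Definition _ := gen_eqMixin (aut X).
HB.instance Definition _ := gen_choiceMixin (aut X).
HB.instance Definition _ := isGroup.Build (aut X) autMA aut1M autM1 autVM autMV.

End AutGroup.

Definition subgroup (G : groupType) : set (set G) :=
  [set H | group_closed (mem H)].

Definition finitely_generated (G : groupType) (H : set G) : Prop :=
  exists2 A : set G, finite_set A & H = smallest (@subgroup G) A.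

(* The fundamental group of L acts on the universal covering K as the group of
   deck transformations of p. *)
Definition deck (K L : cubeComplex) (p : cubeMap K L) : set (aut K) :=
  [set g | forall n (c : K n), p n (g n c) = p n c].

Section Realization.
Context (R : realType).
Local Open Scope ring_scope.
Local Open Scope quotient_scope.

Definition unit_cube (n : nat) : set 'rV[R]_n :=
  [set x | forall i, 0 <= x ord0 i <= 1].
Arguments unit_cube : clear implicits.

Definition face_point m n (f : face m n) (x : 'rV[R]_m) : 'rV[R]_n :=
  \row_i (let z := place 0 f (x ord0) i in if base f i then 1 - z else z).

Definition cell_point (K : cubeComplex) : Type :=
  {n : nat & (discrete_topology (K n) * unit_cube n)%type}.
HB.instance Definition _ K := Topological.on (cell_point K).

Definition mk_point (K : cubeComplex) n (c : K n) (x : unit_cube n) :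
    cell_point K :=
  existT (fun n => (discrete_topology (K n) * unit_cube n)%type) n (c, x).

Variant face_glue1 (K : cubeComplex) : cell_point K -> cell_point K -> Prop :=
| FaceGlue m n (f : face m n) (c : K n) (x : unit_cube m) (y : unit_cube n) of
    set_val y = face_point f (set_val x) :
    face_glue1 (mk_point (restr f c) x) (mk_point c y).

Definition face_glue (K : cubeComplex) : rel (cell_point K) :=
  fun x y => `[< clos_refl_sym_trans _ (@face_glue1 K) x y >].

Lemma face_glue_refl K : reflexive (@face_glue K).
Proof. by move=> x; apply/asboolP; exact: rst_refl. Qed.

Lemma face_glue_sym K : symmetric (@face_glue K).
Proof. by move=> x y; apply/asboolP/asboolP; exact: rst_sym. Qed.

Lemma face_glue_trans K : transitive (@face_glue K).
Proof.
by move=> y x z /asboolP xy /asboolP yz; apply/asboolP; exact: rst_trans xy yz.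
Qed.

Canonical face_glue_equiv K :=
  EquivRel (@face_glue K) (@face_glue_refl K) (@face_glue_sym K) (@face_glue_trans K).

Definition realization (K : cubeComplex) : topologicalType :=
  quotient_topology {eq_quot @face_glue K}.

Definition realize_map (K L : cubeComplex) (g : cubeMap K L) :
    realization K -> realization L :=
  fun z => let: existT n (c, x) := repr z in
    \pi_(realization L) (mk_point (g n c) x).

(* Aut(X) with the topology induced by the compact-open topology on the self
   maps of |X|. *)
Definition aut_top (X : cubeComplex) : topologicalType :=
  initial_topology (fun g : aut X =>
    realize_map g : {compact-open, realization X -> realization X}).

End Realization.

Arguments unit_cube : clear implicits.

Section Labelings.
Context {X : cubeComplex} {Sigma0 : finType}.
Implicit Types (inv : Sigma0 -> Sigma0) (l : X 1 -> Sigma0).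

Definition admissible inv l : Prop :=
  [/\ involutive inv /\ (forall s, inv s <> s),
      (forall e f, parallel e f -> l e = l f) /\
        (forall e, l (rev_edge e) = inv (l e)),
      (forall v e f, start e = v -> start f = v -> l e = l f -> e = f)
    & (forall v w e1 e2 e1' e2',
        start e1 = v -> start e2 = v -> start e1' = w -> start e2' = w ->
        l e1 = l e1' -> l e2 = l e2' ->
        (span_square e1 e2 <-> span_square e1' e2'))].

Definition invariant_labeling (G : set (aut X)) l : Prop :=
  forall g, G g -> forall e, l (g 1 e) = l e.

Definition labels_at l (v : X 0) : set Sigma0 :=
  [set s | exists2 e, start e = v & l e = s].

Definition labels_commute l (s t : Sigma0) : Prop :=
  exists v e f, [/\ start e = v, start f = v, l e = s, l f = t & span_square e f].

(* An oriented diagonal (v, w) of a cube of dimension n.+1 is represented by a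
   parametrisation of the cube sending (0,...,0) to v and (1,...,1) to w. *)
Definition diagonal : Type := {n : nat & X n.+1}.
Definition diag_start (d : diagonal) : X 0 := start (projT2 d).
Definition diag_end (d : diagonal) : X 0 := finish (projT2 d).
Definition diag_edges (d : diagonal) : seq (X 1) :=
  [seq corner (projT2 d) i | i <- enum 'I_(projT1 d).+1].
Definition diag_label l (d : diagonal) : {set Sigma0} :=
  [set s in map l (diag_edges d)].

Definition diag_image (g : aut X) (d : diagonal) : diagonal :=
  existT (fun n => X n.+1) (projT1 d) (g _ (projT2 d)).

Definition diag_labels_at l (v : X 0) : set {set Sigma0} :=
  [set alpha | exists2 d, diag_start d = v & diag_label l d = alpha].

Definition label_sets_commute l (alpha beta : {set Sigma0}) : Prop :=
  forall s t, s \in alpha -> t \in beta -> labels_commute l s t.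

Fixpoint cube_path (v : X 0) (p : seq diagonal) (w : X 0) : Prop :=
  if p is d :: p' then diag_start d = v /\ cube_path (diag_end d) p' w
  else v = w.

Definition word_of l (p : seq diagonal) : seq {set Sigma0} := map (diag_label l) p.

(* The word u is the word of a cube path from o to w. *)
Definition spells l (o : X 0) (u : seq {set Sigma0}) (w : X 0) : Prop :=
  exists2 p, cube_path o p w & word_of l p = u.

Definition cube_language l (o : X 0) : set (seq {set Sigma0}) :=
  [set u | exists w, spells l o u w].

(* A diagonal of a cube C crosses each hyperplane dual to an edge of C once;
   these are the hyperplanes dual to its edges at its starting point. *)
Definition crossings (p : seq diagonal) (h : X 1) : nat :=
  count (fun e => `[< same_hyperplane h e >]) (flatten (map diag_edges p)).

Definition reduced_path (p : seq diagonal) : Prop :=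
  forall h, (crossings p h <= 1)%N.

Definition reduced_word l (o : X 0) (u : seq {set Sigma0}) : Prop :=
  exists p, [/\ exists w, cube_path o p w, word_of l p = u & reduced_path p].

Definition reducible_word l (o : X 0) (u : seq {set Sigma0}) : Prop :=
  cube_language l o u /\ ~ reduced_word l o u.

(* Maps defined on Sigma_{0,v} are represented by total maps on Sigma0, all
   properties being relative to Sigma_{0,v}. *)
Implicit Type sigma : Sigma0 -> Sigma0.

Definition label_morphism l (v : X 0) sigma : Prop :=
  {in labels_at l v &, injective sigma} /\
  {in labels_at l v &, forall s t,
    labels_commute l s t <-> labels_commute l (sigma s) (sigma t)}.

Definition fixes_label sigma (alpha : {set Sigma0}) : Prop :=
  forall s, s \in alpha -> sigma s = s.

Definition compatible l (o : X 0) (u : seq {set Sigma0}) (v : X 0) sigma : Prop :=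
  forall alpha, diag_labels_at l v alpha ->
    reducible_word l o (rcons u alpha) ->
    fixes_label sigma alpha /\
    (forall beta, diag_labels_at l v beta -> label_sets_commute l alpha beta ->
       fixes_label sigma beta).

(* The portrait of g at v agrees with sigma on Sigma_v. *)
Definition portrait_eq l (v : X 0) (g : aut X) sigma : Prop :=
  forall d, diag_start d = v ->
    diag_label l (diag_image g d) = sigma @: diag_label l d.

Definition appears l (o v : X 0) sigma : Prop :=
  exists g : aut X, [/\ g 0 o = o, portrait_eq l v g sigma
    & forall w, type1 o v w \/ type2 o v w -> g 0 w = w].

End Labelings.

(* Main.v *)
(* The labels turn X into a convex piece of the universal cover of a Salvetti
   complex: reading labels along an edge path gives a word, homotopic paths
   give words equal in the right-angled Artin group on Sigma0, and reduced
   words are unique up to shuffling commuting letters.  This yields geodesics,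
   the fact that a geodesic crosses a hyperplane at most once, and a
   description of the hyperplanes separating o from a neighbour of v.

   If an automorphism k fixes the ball of radius n around o, then its local
   action at a vertex v at distance n is compatible with v, hence is realized
   by some g which fixes the ball of radius n + 1 except for the neighbours of
   v, where it agrees with k.  Correcting k at each vertex of the sphere of
   radius n therefore makes it trivial on the ball of radius n + 1.  The
   condition on g depends on v only through the labels of the hyperplanes
   adjacent to v that separate o from v, so up to conjugation by deck
   transformations finitely many such g suffice. *)

Require Import Defs.
From Stdlib Require Import Relation_Operators.
From mathcomp Require Import all_boot all_order all_algebra.
From mathcomp Require Import monoid.
From mathcomp Require Import all_classical all_reals all_analysis.

Set Implicit Arguments.
Unset Strict Implicit.
Unset Printing Implicit Defensive.

Import Order.TTheory GRing.Theory Num.Theory.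
Import numFieldNormedType.Exports.
Local Open Scope classical_set_scope.

(** * Words in a right-angled Artin group *)

Section Words.
Variables (T : eqType) (inv : T -> T) (C : rel T).

Record commutation : Prop := Commutation {
  comm_invK : involutive inv;
  comm_sym : symmetric C;
  comm_irr : forall s, C s s = false;
  comm_inv : forall s t, C (inv s) t = C s t }.

Hypothesis HC : commutation.
Let invK := comm_invK HC.
Let Csym := comm_sym HC.
Let Cirr := comm_irr HC.
Let CV := comm_inv HC.
Implicit Types (s t : T) (u w : seq T).

Inductive shuffle : seq T -> seq T -> Prop :=
| ShuffleRefl u : shuffle u u
| ShuffleSwap a b u : C a b -> shuffle (a :: b :: u) (b :: a :: u)
| ShuffleCons a u w : shuffle u w -> shuffle (a :: u) (a :: w)
| ShuffleTrans w u x : shuffle u w -> shuffle w x -> shuffle u x.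

Lemma shuffle_sym u w : shuffle u w -> shuffle w u.
Proof.
elim=> [x|a b x Cab|a x y _ IH|y x z _ IH1 _ IH2].
- exact: ShuffleRefl.
- by apply: ShuffleSwap; rewrite Csym.
- exact: ShuffleCons.
- exact: ShuffleTrans IH2 IH1.
Qed.

Lemma shuffle_perm u w : shuffle u w -> perm_eq u w.
Proof.
elim=> [x|a b x Cab|a x y _ IH|y x z _ IH1 _ IH2] //.
- by rewrite (perm_catCA [:: a] [:: b] x).
- by rewrite perm_cons.
- exact: perm_trans IH1 IH2.
Qed.

Lemma shuffle_size u w : shuffle u w -> size u = size w.
Proof. by move/shuffle_perm/perm_size. Qed.

(** What is left of [u] once an occurrence of [s] has been commuted to the front; [None] when this
    is impossible. *)
Fixpoint pull s u : option (seq T) :=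
  if u is t :: u' then
    if t == s then Some u' else if C s t then omap (cons t) (pull s u') else None
  else None.

Definition shuffle_opt (a b : option (seq T)) : Prop :=
  match a, b with
  | Some u, Some w => shuffle u w
  | None, None => True
  | _, _ => False
  end.

Lemma shuffle_optxx a : shuffle_opt a a.
Proof. by case: a => //= u; exact: ShuffleRefl. Qed.

Lemma shuffle_opt_cons t a b :
  shuffle_opt a b -> shuffle_opt (omap (cons t) a) (omap (cons t) b).
Proof. by case: a b => [u|] [w|] //=; exact: ShuffleCons. Qed.

(** Makes [pull] well defined on shuffle classes. The case with content is the swap of [a] and [b]:
    irreflexivity of [C] forbids that both equal [s]. *)
Lemma pull_shuffle s u w : shuffle u w -> shuffle_opt (pull s u) (pull s w).
Proof.
elim=> [x|a b x Cab|a x y xy IH|y x z _ IH1 _ IH2] /=.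
- exact: shuffle_optxx.
- have [sa|_] := eqVneq a s; have [sb|_] := eqVneq b s => //.
  + by move: Cab; rewrite sa sb Cirr.
  + by rewrite -sa Cab /=; exact: ShuffleRefl.
  + by rewrite -sb Csym Cab /=; exact: ShuffleRefl.
  + case: (C s a); case: (C s b) => //; case: (pull s x) => //= y.
    exact: ShuffleSwap.
- by case: eqP => // _; case: ifP => // _; exact: shuffle_opt_cons.
- by move: IH1 IH2; case: (pull s x) (pull s y) (pull s z) => [?|] [?|] [?|] //=;
    exact: ShuffleTrans.
Qed.

Lemma pull_Some s u u' : pull s u = Some u' -> shuffle u (s :: u').
Proof.
elim: u u' => //= t u IH u'; have [->|_] := eqVneq t s.
  by move=> [->]; exact: ShuffleRefl.
case: ifP => // Cst; case: (pull s u) IH => //= x /(_ _ erefl) ux [<-].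
apply: ShuffleTrans (ShuffleCons t ux) _.
by apply: ShuffleSwap; rewrite Csym.
Qed.

Lemma pull_head s u : pull s (s :: u) = Some u.
Proof. by rewrite /= eqxx. Qed.

Lemma pull_shuffle_None s u w : shuffle u w -> pull s u = None -> pull s w = None.
Proof. by move/(pull_shuffle s); case: (pull s u) (pull s w) => [?|] [?|]. Qed.

(** Absence of a cancelling pair: no letter is followed by its inverse with only commuting letters
    in between. *)
Fixpoint reduced u : bool :=
  if u is s :: u' then (pull (inv s) u' == None) && reduced u' else true.

Lemma reduced_cons s u : reduced (s :: u) = (pull (inv s) u == None) && reduced u.
Proof. by []. Qed.

Lemma pull_commute s t u : C s t -> pull s (t :: u) = omap (cons t) (pull s u).
Proof.
by move=> Cst /=; case: eqVneq Cst => [->|_ ->//]; rewrite Cirr.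
Qed.

Lemma CV_right s t : C s (inv t) = C s t.
Proof. by rewrite Csym CV Csym. Qed.

Lemma omap_eq_None (A B : Type) (f : A -> B) x : omap f x = None <-> x = None.
Proof. by case: x. Qed.

Lemma reduced_shuffle u w : shuffle u w -> reduced u -> reduced w.
Proof.
elim=> [x|a b x Cab|a x y xy IH|y x z _ IH1 _ IH2] //.
- rewrite !reduced_cons !pull_commute ?CV // 1?Csym //.
  by case: (pull (inv a) x) (pull (inv b) x) => [?|] [?|].
- by move=> /= /andP[/eqP/(pull_shuffle_None xy) -> /IH ->].
- by move=> /IH1/IH2.
Qed.

(* Van der Waerden's trick: letters act on reduced words up to shuffling, which
   solves the word problem without a confluence argument. *)
Definition act s u := if pull (inv s) u is Some u' then u' else s :: u.

Lemma act_shuffle s u w : shuffle u w -> shuffle (act s u) (act s w).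
Proof.
move=> uw; have := pull_shuffle (inv s) uw; rewrite /act.
by case: (pull _ u) (pull _ w) => [?|] [?|] //= _; exact: ShuffleCons.
Qed.

Lemma act_reduced s u : reduced u -> reduced (act s u).
Proof.
rewrite /act; case E: (pull (inv s) u) => [u'|] ru; last by rewrite /= E.
by have /reduced_shuffle/(_ ru)/andP[] := pull_Some E.
Qed.

Lemma act_cons s u : reduced (s :: u) -> act s u = s :: u.
Proof. by move=> /andP[/eqP ru _]; rewrite /act ru. Qed.

Lemma actK s u : reduced u -> shuffle (act (inv s) (act s u)) u.
Proof.
move=> ru; rewrite {2}/act; case E: (pull (inv s) u) => [u'|].
  apply: shuffle_sym; have us := pull_Some E; rewrite act_cons //.
  exact: reduced_shuffle us ru.
by rewrite /act invK pull_head; exact: ShuffleRefl.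
Qed.

(** Together with [actK] this says that the action respects the defining relations of the
    right-angled Artin group. *)
Lemma act_commute s t u :
  C s t -> reduced u -> shuffle (act s (act t u)) (act t (act s u)).
Proof.
(* Removing a letter that commutes with [b] does not make an inaccessible [inv b] accessible. *)
have None_Some a b x x' : C a b -> pull (inv a) x = Some x' ->
    pull (inv b) x = None -> pull (inv b) x' = None.
  move=> Cab /pull_Some xx' /(pull_shuffle_None xx').
  by rewrite pull_commute ?CV ?CV_right 1?Csym // => /omap_eq_None.
move=> Cst ru; have Cts : C t s by rewrite Csym.
rewrite {2 4}/act; case Es: (pull (inv s) u) => [a|]; case Et: (pull (inv t) u) => [b|].
- have := pull_Some Es => ua; have := pull_Some Et => ub.
  have := pull_shuffle (inv t) ua; rewrite Et pull_commute ?CV ?CV_right //.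
  case Ea: (pull (inv t) a) => [c|] //= bc.
  have := pull_shuffle (inv s) bc; rewrite pull_head /act Ea.
  by case: (pull (inv s) b).
- rewrite /act pull_commute ?CV // Es /= (None_Some _ _ _ _ Cst Es Et).
  exact: ShuffleRefl.
- rewrite /act pull_commute ?CV // Et /= (None_Some _ _ _ _ Cts Et Es).
  exact: ShuffleRefl.
- rewrite /act !pull_commute ?CV // Es Et /=.
  exact: ShuffleSwap.
Qed.

Definition run u w := foldr act w u.

Lemma run_shuffle u w w' : shuffle w w' -> shuffle (run u w) (run u w').
Proof. by move=> ww'; elim: u => //= s u; exact: act_shuffle. Qed.

Lemma run_reduced u w : reduced w -> reduced (run u w).
Proof. by move=> rw; elim: u => //= s u; exact: act_reduced. Qed.

(** Running a word on the empty word thus gives a normal form up to shuffling, and reduced words are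
    already in it. *)
Lemma run_nil u : reduced u -> run u [::] = u.
Proof.
by elim: u => //= s u IH /[dup] rsu /andP[_ /IH ->]; exact: act_cons.
Qed.

Lemma run_rev u w : reduced w -> shuffle (run (map inv (rev u)) (run u w)) w.
Proof.
move=> rw; elim: u => /= [|s u IH]; first exact: ShuffleRefl.
rewrite rev_cons map_rcons /run foldr_rcons -!/(run _ _).
by apply: ShuffleTrans (run_shuffle _ (actK _ (run_reduced _ rw))) IH.
Qed.

Lemma size_run u w : size (run u w) <= size u + size w.
Proof.
elim: u => //= s u IH; rewrite /act; case E: (pull _ _) => [x|] //=.
by have /shuffle_size /= e := pull_Some E; rewrite e in IH; apply: ltnW; exact: leqW.
Qed.

Lemma all_run (P : pred T) u : all P u -> all P (run u [::]).
Proof.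
elim: u => //= s u IH /andP[Ps /IH Pu]; rewrite /act.
case E: (pull _ _) => [x|] /=; last by rewrite Ps.
by have /shuffle_perm/perm_all := pull_Some E => /(_ P); rewrite Pu => /esym/andP[].
Qed.

Lemma pull_cat s u w :
  all (C s) u -> pull s (u ++ w) = omap (cat u) (pull s w).
Proof.
elim: u => [_|t u IH /andP[st /IH e]].
  by rewrite /=; case: (pull s w).
by rewrite cat_cons pull_commute // e; case: (pull s w).
Qed.

Lemma pull_cat_Some s u w x : pull s (u ++ w) = Some x -> pull s u = None ->
  all (C s) u /\ exists w', pull s w = Some w'.
Proof.
elim: u x => [|t u IH] x /=; first by move=> E _; split => //; exists x.
case: eqP => // _; case: ifP => // st; case E: (pull s (u ++ w)) => [y|] //= _.
by move/omap_eq_None => /(IH _ E)[au].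
Qed.

Lemma shuffle_rcons s u : all (C s) u -> shuffle (rcons u s) (s :: u).
Proof.
elim: u => [_|t u IH /andP[st au]]; first exact: ShuffleRefl.
rewrite rcons_cons; apply: ShuffleTrans (ShuffleCons _ (IH au)) _.
by apply: ShuffleSwap; rewrite Csym.
Qed.

(** Since both factors are reduced, a cancelling pair has one letter in each, and both letters can
    be commuted to the seam. *)
Lemma reduced_cat u w : reduced u -> reduced w -> ~~ reduced (u ++ w) ->
  exists s w' u', shuffle w (s :: w') /\ shuffle u (rcons u' (inv s)).
Proof.
elim: u => [|t u IH]; first by move=> _ /= ->.
move=> /= /andP[/eqP tu ru] rw; rewrite negb_and.
have [|/(IH ru rw)[s [w' [u' [ww' uu']]]] _] := boolP (reduced (u ++ w)); last first.
  by exists s, w', (t :: u'); split => //; exact: ShuffleCons.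
rewrite orbF; case E: (pull _ _) => [x|] // _ _.
have [au [w' ww']] := pull_cat_Some E tu.
exists (inv t), w', u; rewrite invK; split; first exact: pull_Some.
by apply/shuffle_sym/shuffle_rcons; apply: sub_all au => a; rewrite CV.
Qed.

Lemma reduced_catl u w : reduced (u ++ w) -> reduced u.
Proof.
elim: u => //= s u IH /andP[/eqP sn /IH ->]; rewrite andbT.
case E: (pull _ u) => [x|] //.
suff: pull (inv s) (u ++ w) = Some (x ++ w) by rewrite sn.
elim: u x E {IH sn} => //= t u IH x; case: eqP => [_ [->]|_] //.
by case: ifP => // _; case: (pull _ u) IH => //= y /(_ _ erefl) -> [<-].
Qed.

End Words.

(** * Cubes, edge paths and hyperplanes *)

Section Faces.

Lemma face_eq m n (f g : face m n) :
  dir f =1 dir g -> base f =1 base g -> f = g.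
Proof.
case: f g => [d b i] [d' b' i'] /= /ffunP dd /ffunP bb.
by case: _ / dd in i' *; case: _ / bb; congr Face; exact: bool_irrelevance.
Qed.

Lemma face_vertexE m n (f : face m n) b k :
  face_vertex f b (dir f k) = base f (dir f k) (+) b k.
Proof.
rewrite ffunE /place; case: pickP => [j /eqP/(injectiveP _ (dir_inj f)) -> //|].
by move=> /(_ k); rewrite eqxx.
Qed.

Lemma face_vertex0 m n (f : face m n) : face_vertex f (b0 m) = base f.
Proof.
apply/ffunP => i; rewrite ffunE /place.
by case: pickP => [j|] /=; rewrite ?ffunE addbF.
Qed.

Definition flip n (i : 'I_n) (b : {ffun 'I_n -> bool}) : {ffun 'I_n -> bool} :=
  [ffun j => b j (+) (j == i)].

Lemma flipK n (i : 'I_n) : involutive (flip i).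
Proof. by move=> b; apply/ffunP => j; rewrite !ffunE addbK. Qed.

Lemma flipC n (i j : 'I_n) b : flip i (flip j b) = flip j (flip i b).
Proof. by apply/ffunP => k; rewrite !ffunE addbAC. Qed.

Lemma face_vertex_edgeface n (i : 'I_n) b x :
  face_vertex (edgeface i b) x = if x ord0 then flip i b else b.
Proof.
apply/ffunP => j; rewrite ffunE /place.
case: pickP => [k|] /=.
  rewrite ffunE ord1 => /eqP <-.
  by case: (x ord0); rewrite ?ffunE ?eqxx ?addbF.
move=> /(_ ord0); rewrite ffunE => /eqP ij; rewrite addbF.
by case: (x ord0) => //; rewrite ffunE; case: eqP => [/esym //|]; rewrite addbF.
Qed.

(** Reparametrises a cube so that its vertex [b] becomes its start; statements about [start] and
    [corner] then transfer to every vertex. *)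
Definition reflface n (b : {ffun 'I_n -> bool}) : face n n := Face b (idface_inj n).

Lemma face_vertex_reflface n (b x : {ffun 'I_n -> bool}) :
  face_vertex (reflface b) x = [ffun i => b i (+) x i].
Proof.
apply/ffunP => i; have := face_vertexE (reflface b) x i.
by rewrite {1 2}/reflface /= !ffunE => ->.
Qed.

Lemma swapface_inj : injectiveb [ffun i : 'I_2 => rev_ord i].
Proof. by apply/injectiveP => i j; rewrite !ffunE => /rev_ord_inj. Qed.

Definition swapface : face 2 2 := Face (b0 2) swapface_inj.

Lemma ord2P (i : 'I_2) : i = ord0 \/ i = ord_max.
Proof. by case: i => -[|[|//]] h; [left|right]; apply/val_inj. Qed.

Lemma rev_ord2 : (rev_ord (ord0 : 'I_2) = ord_max) * (rev_ord (ord_max : 'I_2) = ord0).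
Proof. by split; apply/val_inj. Qed.

Lemma flip_opposite i (b b' : {ffun 'I_2 -> bool}) :
  b i = b' i -> b = b' \/ exists2 j, i != j & b' = flip j b.
Proof.
move=> bi; have [j ij jP] : exists2 j : 'I_2, i != j & forall k, k = i \/ k = j.
  by case: (ord2P i) => ->; [exists ord_max|exists ord0] => // k;
    case: (ord2P k) => ->; by [left|right].
have [bj|bj] := eqVneq (b j) (b' j); [left|right; exists j => //];
  apply/ffunP => k; rewrite ?ffunE; case: (jP k) => -> //.
  by rewrite (negPf ij) addbF.
by rewrite eqxx addbT; case: (b j) (b' j) bj => -[].
Qed.

End Faces.

Section CellAlgebra.
Context {K : cubeComplex}.

Lemma cvert_restr m n (f : face m n) b (c : K n) :
  cvert b (restr f c) = cvert (face_vertex f b) c.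
Proof. by rewrite /cvert -restr_comp; congr restr; apply: face_eq => [[]|]. Qed.

Lemma cedge_restr m n (f : face m n) i b (c : K n) :
  cedge i b (restr f c) = cedge (dir f i) (face_vertex f b) c.
Proof.
by rewrite /cedge -restr_comp; congr restr; apply: face_eq => // j; rewrite !ffunE.
Qed.

Lemma start_restr m n (f : face m n) (c : K n) : start (restr f c) = cvert (base f) c.
Proof. by rewrite /start cvert_restr face_vertex0. Qed.

Lemma start_cedge n (i : 'I_n) b (c : K n) : start (cedge i b c) = cvert b c.
Proof. by rewrite start_restr. Qed.

Lemma finish_cedge n (i : 'I_n) b (c : K n) :
  finish (cedge i b c) = cvert (flip i b) c.
Proof. by rewrite /finish cvert_restr face_vertex_edgeface ffunE. Qed.

Lemma cedge_id (e : K 1) : cedge ord0 (b0 1) e = e.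
Proof.
rewrite -[RHS]restr_id; congr restr; apply: face_eq => i; rewrite !ffunE //.
by rewrite !ord1.
Qed.

Lemma corner_edge (e : K 1) i : corner e i = e.
Proof. by rewrite ord1; exact: cedge_id. Qed.

Lemma rev_cedge n (i : 'I_n) b (c : K n) : rev_edge (cedge i b c) = cedge i (flip i b) c.
Proof. by rewrite /rev_edge cedge_restr face_vertex_edgeface !ffunE. Qed.

Lemma rev_edgeK : involutive (@rev_edge K).
Proof. by move=> e; rewrite -(cedge_id e) !rev_cedge flipK. Qed.

Lemma start_rev (e : K 1) : start (rev_edge e) = finish e.
Proof. by rewrite -(cedge_id e) rev_cedge start_cedge finish_cedge. Qed.

Lemma finish_rev (e : K 1) : finish (rev_edge e) = start e.
Proof. by rewrite -(cedge_id e) rev_cedge start_cedge finish_cedge flipK. Qed.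

Lemma face1E n (f : face 1 n) (c : K n) : restr f c = cedge (dir f ord0) (base f) c.
Proof.
by rewrite /cedge; congr restr; apply: face_eq => i //=; rewrite ffunE ord1.
Qed.

Lemma opposite_rev (e f : K 1) :
  opposite_in_square e f -> opposite_in_square (rev_edge e) (rev_edge f).
Proof.
move=> [c [i [b [b' [bb -> ->]]]]]; exists c, i, (flip i b), (flip i b').
by rewrite !ffunE bb !rev_cedge.
Qed.

Lemma parallel_rev (e f : K 1) : parallel e f -> parallel (rev_edge e) (rev_edge f).
Proof.
elim=> [x y /opposite_rev xy|x|x y _ xy|x y z _ xy _ yz].
- exact: rst_step.
- exact: rst_refl.
- exact: rst_sym.
- exact: rst_trans xy yz.
Qed.

Lemma parallel_refl (e : K 1) : parallel e e.
Proof. exact: rst_refl. Qed.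

Lemma parallel_sym (e f : K 1) : parallel e f -> parallel f e.
Proof. exact: rst_sym. Qed.

Lemma parallel_trans (f e g : K 1) : parallel e f -> parallel f g -> parallel e g.
Proof. exact: rst_trans. Qed.

Lemma same_hyperplane_refl (e : K 1) : same_hyperplane e e.
Proof. by left; exact: parallel_refl. Qed.

Lemma same_hyperplane_rev (h e : K 1) :
  same_hyperplane h (rev_edge e) <-> same_hyperplane h e.
Proof. by rewrite /same_hyperplane rev_edgeK; split=> -[]; [right|left|right|left]. Qed.

Lemma same_hyperplane_parallel (h e f : K 1) :
  parallel e f -> same_hyperplane h e <-> same_hyperplane h f.
Proof.
move=> ef; have fe := parallel_sym ef; have := parallel_rev ef.
have := parallel_rev fe => rfe ref.
split=> -[he|he]; [left|right|left|right]; apply: parallel_trans he _ => //.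
Qed.

Lemma same_hyperplane_sym (e f : K 1) : same_hyperplane e f -> same_hyperplane f e.
Proof.
move=> [/parallel_sym|/parallel_sym/parallel_rev]; first by left.
by rewrite rev_edgeK; right.
Qed.

Lemma same_hyperplane_trans (f e g : K 1) :
  same_hyperplane e f -> same_hyperplane f g -> same_hyperplane e g.
Proof.
move=> ef [fg|fg]; have E := same_hyperplane_parallel e fg; first exact/E.
exact/same_hyperplane_rev/E.
Qed.

Lemma edge_path_cat v p q w :
  edge_path (K := K) v (p ++ q) w <-> exists2 x, edge_path v p x & edge_path x q w.
Proof.
elim: p v => [|e p IH] v /=.
  by split=> [vq|[x ->] //]; exists v.
split=> [[<- /IH[x px xq]]|[x [<- px] xq]]; first by exists x.
by split=> //; apply/IH; exists x.
Qed.

Lemma edge_path_rcons v p e w :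
  edge_path (K := K) v (rcons p e) w <-> edge_path v p (start e) /\ finish e = w.
Proof.
rewrite -cats1 edge_path_cat /=.
by split=> [[x + [-> <-]] //|[pe <-]]; exists (start e).
Qed.

Definition rev_edges (p : seq (K 1)) := map (@rev_edge K) (rev p).

Lemma edge_path_rev v p w : edge_path v p w -> edge_path w (rev_edges p) v.
Proof.
elim: p v => [|e p IH] v /=; first by move->.
move=> [<- /IH ep]; rewrite /rev_edges rev_cons map_rcons edge_path_rcons.
by rewrite start_rev finish_rev.
Qed.

Definition cross (h : K 1) (p : seq (K 1)) : nat :=
  count (fun e => `[< same_hyperplane h e >]) p.

Lemma cross_rev h p : cross h (rev_edges p) = cross h p.
Proof.
rewrite /cross count_map count_rev; apply: eq_count => e /=.
by apply/asboolP/asboolP => /same_hyperplane_rev.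
Qed.

Lemma cross_homotopic v w p q :
  homotopic (K := K) v w p q -> forall h, odd (cross h p) = odd (cross h q).
Proof.
move=> H h; elim: H => {p q}[p q [_ _ pq]|//|x y _ -> //|x y z _ -> _ -> //].
case: pq => {p q} p q.
  move=> e; rewrite /cross !count_cat /= !oddD.
  have -> : `[< same_hyperplane h (rev_edge e) >] = `[< same_hyperplane h e >].
    by apply/asboolP/asboolP => /same_hyperplane_rev.
  by case: `[< _ >]; case: (odd _).
move=> c b b'; rewrite /cross !count_cat /= !oddD.
have par i (x x' : {ffun 'I_2 -> bool}) : x i = x' i ->
    `[< same_hyperplane h (cedge i x c) >] = `[< same_hyperplane h (cedge i x' c) >].
  move=> xx; have /(same_hyperplane_parallel h) par : parallel (cedge i x c) (cedge i x' c).
    by apply: rst_step; exists c, i, x, x'.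
  by apply/asboolP/asboolP; rewrite par.
rewrite (par ord_max b (b0 2)) ?ffunE // (par ord0 b' (b0 2)) ?ffunE //.
by do 2!case: `[< _ >].
Qed.

Lemma crossP (h : K 1) p : cross h p = 0 <-> (forall e, e \in p -> ~ same_hyperplane h e).
Proof.
split=> [/eqP|H].
  by rewrite -leqn0 leqNgt -has_count => /hasPn H e /H/asboolP.
by apply/eqP; rewrite -leqn0 leqNgt -has_count; apply/hasPn => e /H/asboolPn.
Qed.

Lemma halfspace_sym h a b : halfspace (K := K) h a b -> halfspace h b a.
Proof.
move=> [p pab /crossP ph]; exists (rev_edges p); first exact: edge_path_rev.
by apply/crossP; rewrite cross_rev.
Qed.

End CellAlgebra.

Section CubeMaps.
Context {K L : cubeComplex} (g : cubeMap K L).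

Lemma cmap_cedge n i b (c : K n) : g 1 (cedge i b c) = cedge i b (g n c).
Proof. exact: cmap_restr. Qed.

Lemma cmap_start n (c : K n) : g 0 (start c) = start (g n c).
Proof. exact: cmap_restr. Qed.

Lemma cmap_finish n (c : K n) : g 0 (finish c) = finish (g n c).
Proof. exact: cmap_restr. Qed.

Lemma cmap_rev e : g 1 (rev_edge e) = rev_edge (g 1 e).
Proof. exact: cmap_cedge. Qed.

Lemma cmap_parallel e f : parallel e f -> parallel (g 1 e) (g 1 f).
Proof.
elim=> [x y [c [i [b [b' [bb -> ->]]]]]|x|x y _ xy|x y z _ xy _ yz].
- by apply: rst_step; exists (g 2 c), i, b, b'; rewrite !cmap_cedge.
- exact: rst_refl.
- exact: rst_sym.
- exact: rst_trans xy yz.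
Qed.

Lemma cmap_same_hyperplane e f :
  same_hyperplane e f -> same_hyperplane (g 1 e) (g 1 f).
Proof.
by rewrite /same_hyperplane -cmap_rev => -[] /cmap_parallel; [left|right].
Qed.

Lemma cmap_path v p w : edge_path v p w -> edge_path (g 0 v) (map (g 1) p) (g 0 w).
Proof.
elim: p v => [|e p IH] v /=; first by move->.
by move=> [<- /IH]; rewrite cmap_start cmap_finish.
Qed.

End CubeMaps.

Section Automorphisms.
Context {X : cubeComplex}.
Implicit Types g h : aut X.

Lemma aut_mulE g h n (c : X n) : (g * h)%g n c = g n (h n c). Proof. by []. Qed.

Lemma aut_invK g n (c : X n) : g^-1%g n (g n c) = c. Proof. exact: amapK. Qed.

Lemma aut_invKV g n (c : X n) : g n (g^-1%g n c) = c. Proof. exact: ainvK. Qed.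

Lemma aut_inj g n : injective (g n). Proof. exact: can_inj (@amapK X g n). Qed.

Lemma aut_halfspace g e v w : halfspace e v w -> halfspace (g 1 e) (g 0 v) (g 0 w).
Proof.
move=> [p pvw np]; exists (map (g 1) p); first exact: cmap_path.
move=> _ /mapP[f fp ->] /(cmap_same_hyperplane (g^-1)%g).
by rewrite !aut_invK; exact: np.
Qed.

End Automorphisms.

(** * Complexes with an admissible labeling *)

Section LabelledComplex.
Context {X : cubeComplex} {Sigma0 : finType}.
Variables (inv : Sigma0 -> Sigma0) (l : X 1 -> Sigma0).
Hypothesis linksX : simplicial_links (K := X).
Hypothesis simplyX : simply_connected X.
Hypothesis adml : admissible inv l.

Lemma label_parallel e f : parallel e f -> l e = l f.
Proof. by case: adml => _ [+ _] _ _; apply. Qed.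

Lemma label_rev e : l (rev_edge e) = inv (l e).
Proof. by case: adml => _ [_ +] _ _; apply. Qed.

Lemma label_inj e f : start e = start f -> l e = l f -> e = f.
Proof. by case: adml => _ _ + _ sef; apply; [exact: sef|]. Qed.

Lemma label_invK : involutive inv.
Proof. by case: adml => -[]. Qed.

(** Boolean form of [labels_commute] (see [labels_commuteE]), phrased with the corner of a single
    square so that it can serve as the relation [C] on words. *)
Definition commuting (s t : Sigma0) : bool :=
  `[< exists c : X 2, l (corner c ord0) = s /\ l (corner c ord_max) = t >].

Lemma corner_reflect n (b : {ffun 'I_n -> bool}) (c : X n) i :
  corner (restr (reflface b) c) i = cedge i b c.
Proof. by rewrite /corner cedge_restr face_vertex0 /= ffunE. Qed.

Lemma corner_swap (c : X 2) i :
  corner (restr swapface c) i = cedge (rev_ord i) (b0 2) c.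
Proof. by rewrite /corner cedge_restr face_vertex0 /= ffunE. Qed.

Lemma label_opposite (c : X 2) i (b b' : {ffun 'I_2 -> bool}) :
  b i = b' i -> l (cedge i b c) = l (cedge i b' c).
Proof. by move=> bb; apply/label_parallel/rst_step; exists c, i, b, b'. Qed.

Lemma commuting_sym : symmetric commuting.
Proof.
suff H s t : commuting s t -> commuting t s by move=> s t; apply/idP/idP; exact: H.
move=> /asboolP[c [<- <-]]; apply/asboolP; exists (restr swapface c).
by rewrite !corner_swap !rev_ord2.
Qed.

Lemma commuting_cedge (c : X 2) i j b :
  i != j -> commuting (l (cedge i b c)) (l (cedge j b c)).
Proof.
have H : commuting (l (cedge ord0 b c)) (l (cedge ord_max b c)).
  by apply/asboolP; exists (restr (reflface b) c); rewrite !corner_reflect.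
case: (ord2P i) (ord2P j) => -> [] -> //.
by rewrite commuting_sym.
Qed.

Lemma commuting_irr s : commuting s s = false.
Proof.
apply/negP => /asboolP[c [cs ct]].
have : corner c ord0 = corner c ord_max.
  by apply: label_inj; rewrite ?start_cedge // cs.
by move/(linksX.1 2 c).
Qed.

(** Read the same square at the other end of its side labelled [s]. *)
Lemma commuting_inv s t : commuting (inv s) t = commuting s t.
Proof.
have H x y : commuting x y -> commuting (inv x) y.
  move=> /asboolP[c [<- <-]]; rewrite -label_rev rev_cedge.
  rewrite (@label_opposite c ord_max _ (flip ord0 (b0 2))) ?ffunE //.
  exact: commuting_cedge.
by apply/idP/idP => /H //; rewrite label_invK.
Qed.

Lemma commuting_commutation : commutation inv commuting.
Proof.
exact: Commutation label_invK commuting_sym commuting_irr commuting_inv.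
Qed.

Local Notation HC := commuting_commutation.
Notation shuffle := (shuffle commuting).
Notation reduced := (reduced inv commuting).
Notation run := (run inv commuting).
Notation word := (map l).

(** * Words of edge paths and geodesics *)

Lemma word_rev p : word (rev_edges p) = map inv (rev (word p)).
Proof.
rewrite /rev_edges -map_comp -map_rev -map_comp.
by apply: eq_map => e /=; rewrite label_rev.
Qed.

Lemma run_cat u v w : run (u ++ v) w = run u (run v w).
Proof. exact: foldr_cat. Qed.

(** The elementary homotopies match the group relations: a backtrack is handled by [actK], a square
    by [act_commute]. *)
Lemma run_homotopic v w p q : homotopic v w p q ->
  forall u, reduced u -> shuffle (run (word p) u) (run (word q) u).
Proof.
elim=> {p q}[p q [_ _ pq]|p|p q _ pq|p q r _ pq _ qr] u ru; first last.
- exact: ShuffleTrans (pq _ ru) (qr _ ru).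
- exact/(shuffle_sym HC)/pq.
- exact: ShuffleRefl.
case: pq => {p q} p q.
  move=> e; rewrite !map_cat !run_cat; apply: (run_shuffle HC).
  rewrite /= label_rev -{1}[l e]label_invK; apply: (actK HC).
  exact: run_reduced HC _ _ ru.
move=> c b b'; rewrite !map_cat !run_cat; apply: (run_shuffle HC) => /=.
rewrite (@label_opposite c ord_max b (b0 2)) ?ffunE //.
rewrite (@label_opposite c ord0 b' (b0 2)) ?ffunE //.
apply: (act_commute HC) => //; first exact: commuting_cedge.
exact: run_reduced HC _ _ ru.
Qed.

Lemma edge_path_loop a b (p q : seq (X 1)) : edge_path a p b -> edge_path a q b ->
  homotopic b b (rev_edges q ++ p) [::].
Proof.
move=> pab qab; apply: simplyX.2; rewrite edge_path_cat; exists a => //.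
exact: edge_path_rev.
Qed.

(** The loop formed by [p] and the reverse of [q] is null-homotopic, so it acts trivially; letting
    [q] act afterwards cancels its inverse. *)
Lemma run_unique a b p q : edge_path a p b -> edge_path a q b ->
  shuffle (run (word p) [::]) (run (word q) [::]).
Proof.
move=> pab qab; have := run_homotopic (edge_path_loop pab qab) (u := [::]) erefl.
rewrite map_cat run_cat word_rev => /(run_shuffle HC (word q)).
apply: ShuffleTrans; apply: (shuffle_sym HC).
have := run_rev HC (map inv (rev (word q))) (run_reduced HC (word p) (w := [::]) erefl).
by rewrite -(map_rev inv) revK mapK //; exact: label_invK.
Qed.

Lemma reduced_unique a b p q : edge_path a p b -> edge_path a q b ->
  reduced (word p) -> reduced (word q) -> shuffle (word p) (word q).
Proof.
move=> pab qab rp rq; have := run_unique pab qab.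
by rewrite !run_nil.
Qed.

(** Reduced paths are geodesics, because [run] never lengthens a word. *)
Lemma reduced_size a b p q : edge_path a p b -> edge_path a q b ->
  reduced (word p) -> size p <= size q.
Proof.
move=> pab qab rp; have /shuffle_size := run_unique pab qab.
rewrite (run_nil rp) size_map => ->.
by have := size_run HC (word q) [::]; rewrite size_map addn0.
Qed.

Lemma reduced_loop a p : edge_path a p a -> reduced (word p) -> p = [::].
Proof.
move=> pa rp; have := @reduced_size a a p [::] pa erefl rp.
by case: p {pa rp}.
Qed.

Lemma start_neq_finish (e : X 1) : start e <> finish e.
Proof.
move=> e0; suff : [:: e] = [::] by [].
by apply: (@reduced_loop (start e)) => //=; rewrite -e0.
Qed.

(** One-letter words are reduced, so uniqueness equates the labels. Hence automorphisms are
    determined on edges by their values on vertices. *)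
Lemma edge_rigid (e f : X 1) : start e = start f -> finish e = finish f -> e = f.
Proof.
move=> sef fef; apply: label_inj => //.
have /shuffle_perm : shuffle (word [:: e]) (word [:: f]).
  by apply: (@reduced_unique (start e) (finish e)).
by move/perm_mem/(_ (l e)); rewrite !inE eqxx => /esym/eqP.
Qed.

(** An identification of adjacent vertices would make a side a loop; one of opposite vertices would
    close up a two-letter path, which is reduced because commuting letters are not mutually
    inverse. *)
Lemma cvert0_inj (c : X 2) b : cvert b c = start c -> b = b0 2.
Proof.
move=> cb; case: (pselect (b = b0 2)) => // nb; exfalso.
have H i j : i != j -> b i -> ~~ b j -> False.
  move=> ij bi bj; apply: (@start_neq_finish (corner c i)).
  rewrite start_cedge finish_cedge -/(start c) -cb; congr (cvert _ c).
  apply/ffunP => k; rewrite !ffunE.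
  by case: (ord2P i) ij bi => ->; case: (ord2P j) bj => -> //; case: (ord2P k) => -> //
    /negPf bj _ bi; rewrite ?bj ?bi.
case b0E: (b ord0); case b1E: (b ord_max).
- suff : [:: corner c ord0; cedge ord_max (flip ord0 (b0 2)) c] = [::] by [].
  apply: (@reduced_loop (start c)) => /=.
    rewrite !start_cedge !finish_cedge; split => //; split => //.
    rewrite -cb; congr (cvert _ c); apply/ffunP => k; rewrite !ffunE.
    by case: (ord2P k) => ->; rewrite ?b0E ?b1E.
  rewrite (@label_opposite c ord_max _ (b0 2)) ?ffunE // andbT.
  have := @commuting_cedge c ord0 ord_max (b0 2) isT.
  rewrite /corner; set s := l _; set t := l _ => st.
  case: (t =P inv s) => [E|_]; last by case: ifP.
  exfalso; move: st; rewrite E commuting_sym.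
  by rewrite commuting_inv commuting_irr.
- by apply: (H ord0 ord_max); rewrite ?b0E ?b1E.
- by apply: (H ord_max ord0); rewrite ?b0E ?b1E.
- by apply: nb; apply/ffunP => k; rewrite ffunE; case: (ord2P k) => ->.
Qed.

Lemma cvert2_inj (c : X 2) b b' : cvert b c = cvert b' c -> b = b'.
Proof.
move=> bb; apply/esym; have := @cvert0_inj (restr (reflface b) c) [ffun i => b i (+) b' i].
rewrite start_restr cvert_restr face_vertex_reflface /=.
have -> : [ffun i => b i (+) [ffun i => b i (+) b' i] i] = b'.
  by apply/ffunP => i; rewrite !ffunE addKb.
move=> /(_ (esym bb)) /ffunP H; apply/ffunP => i; have := H i.
by rewrite !ffunE; case: (b i) (b' i) => -[].
Qed.

Lemma square_corner_sym e f : square_corner (K := X) e f -> square_corner f e.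
Proof.
move=> [c [<- <-]]; exists (restr swapface c).
by rewrite !corner_swap !rev_ord2.
Qed.

(** As the four vertices of a square are distinct, two of its sides with a common start are its two
    corner edges there, up to order, as soon as they share no other endpoint. *)
Lemma span_square_corner e f : start e = start f ->
  span_square (K := X) e f <-> square_corner e f.
Proof.
move=> sef; split.
  move=> [[v [_ vu]] [c [[f1 e1] [f2 e2]]]]; rewrite -e1 -e2 in sef vu *.
  rewrite !face1E in sef vu *; move: sef vu.
  move: (dir f1 _) (dir f2 _) (base f1) (base f2) => i j b b'.
  rewrite !start_cedge => /cvert2_inj <- {b'} vu.
  have ij : i != j.
    apply/eqP => ij; rewrite -ij in vu; apply: (@start_neq_finish (cedge i b c)).
    by transitivity v; [apply/esym|]; apply: vu; split; [left|left|right|right].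
  have H : square_corner (cedge ord0 b c) (cedge ord_max b c).
    by exists (restr (reflface b) c); rewrite !corner_reflect.
  case: (ord2P i) (ord2P j) ij => -> [] -> // _.
  exact: square_corner_sym.
move=> [c [ce cf]]; split; last by exists c; rewrite -ce -cf; split; eexists.
exists (start e); split; first by split; left.
have fin i j : start (corner c i) <> finish (corner c j).
  rewrite start_cedge finish_cedge => /cvert2_inj /ffunP/(_ j).
  by rewrite !ffunE eqxx.
move=> v [[->|->]] // [] //; rewrite -ce -cf.
- by move/esym/fin.
- rewrite !finish_cedge => /cvert2_inj/ffunP/(_ ord0).
  by rewrite !ffunE.
Qed.

Lemma square_corner_commuting e f : square_corner e f -> commuting (l e) (l f).
Proof. by move=> [c [<- <-]]; exact: commuting_cedge. Qed.

Lemma labels_commuteE s t : labels_commute l s t <-> commuting s t.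
Proof.
split=> [[v [e [f [se sf <- <-]]]]|/asboolP[c [<- <-]]].
  by rewrite span_square_corner ?se ?sf //; exact: square_corner_commuting.
exists (start c), (corner c ord0), (corner c ord_max); rewrite !start_cedge; split => //.
by apply/span_square_corner; rewrite ?start_cedge //; exists c.
Qed.

(** Here axiom (A3) enters: a square seen at one vertex exists at every vertex that has outgoing
    edges with these labels. *)
Lemma commuting_square e f : start e = start f -> commuting (l e) (l f) ->
  square_corner e f.
Proof.
move=> sef /labels_commuteE[v [e' [f' [se sf le lf]]]].
case: adml => _ _ _ A3; have [+ _] := A3 _ _ _ _ _ _ se sf (erefl _) (esym sef) le lf.
by move=> H /H /span_square_corner; apply.
Qed.

Lemma square_sides e f : square_corner (K := X) e f ->
  exists e' f', [/\ parallel e e', parallel f f', start e' = finish f,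
    start f' = finish e & finish e' = finish f'].
Proof.
move=> [c [<- <-]].
exists (cedge ord0 (flip ord_max (b0 2)) c), (cedge ord_max (flip ord0 (b0 2)) c).
rewrite !start_cedge !finish_cedge flipC; split => //; apply: rst_step.
  by exists c, ord0, (b0 2), (flip ord_max (b0 2)); rewrite !ffunE.
by exists c, ord_max, (b0 2), (flip ord0 (b0 2)); rewrite !ffunE.
Qed.

(** Swapping two commuting letters pushes the path across a square. *)
Lemma edge_path_shuffle a b p w : shuffle (word p) w -> edge_path a p b ->
  exists2 q, edge_path a q b & word q = w.
Proof.
move E: (word p) => u uw; elim: uw a b p E.
- by move=> {}u a b p <- pab; exists p.
- move=> s t {}u st a b [|e [|f p]] //= [es ft pu] [<- [fe pb]].
  (* The square is found at the middle vertex of the two edges, where [rev_edge e] and [f] both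
     start. *)
  have [] := @commuting_square (rev_edge e) f.
  + by rewrite start_rev.
  + by rewrite label_rev commuting_inv es ft.
  move=> c ce; have /square_sides[e' [f' [pe pf se sf ef]]] :
    square_corner (rev_edge e) f by exists c.
  rewrite finish_rev in sf; exists [:: f', rev_edge e' & p].
    by rewrite /= start_rev finish_rev se ef.
  by rewrite /= label_rev -(label_parallel pe) -(label_parallel pf) label_rev
    label_invK es ft pu.
- move=> s {}u {}w _ IH a b [|e p] //= [<- pu] [<- pb].
  by have [q qb qw] := IH _ _ _ pu pb; exists (e :: q); rewrite //= qw.
- move=> {}w {}u x _ IH1 _ IH2 a b p pu pab.
  by have [q qab qw] := IH1 _ _ _ pu pab; exact: IH2 qw qab.
Qed.

(** Prepend edges one at a time. When the new letter cancels, the reduced path can be shuffled to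
    begin with the reversed edge, and the backtrack is dropped. *)
Lemma reduced_path_exists a b : exists2 p, edge_path a p b & reduced (word p).
Proof.
have [q] := simplyX.1 a b; elim: q a => [|e q IH] a /=.
  by move=> <-; exists [::].
move=> [<- /IH[p pab rp]].
case E: (pull commuting (inv (l e)) (word p)) => [u|]; last first.
  by exists (e :: p) => //=; rewrite E.
have pu := pull_Some HC E.
have [q' q'b q'w] := edge_path_shuffle pu pab.
case: q' q'b q'w => // f q' /= [sf q'b] [lf q'u].
have fe : f = rev_edge e by apply: label_inj; rewrite ?start_rev // label_rev.
rewrite fe finish_rev in q'b; exists q' => //.
by rewrite q'u; have := reduced_shuffle HC pu rp; rewrite reduced_cons => /andP[].
Qed.

Lemma parallel_path (e f : X 1) : parallel e f ->
  exists2 p, edge_path (start e) p (start f) & all (commuting (l e)) (word p).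
Proof.
elim=> {e f}[e f [c [i [b [b' [bi -> ->]]]]]|e|e f ef [p pe pc]|
  e f g ef [p pe pc] fg [q qf qc]].
- rewrite !start_cedge; case: (flip_opposite bi) => [->|[j ij ->]].
    by exists [::].
  exists [:: cedge j b c]; first by rewrite /= start_cedge finish_cedge.
  by rewrite /= commuting_cedge.
- by exists [::].
- exists (rev_edges p); first exact: edge_path_rev.
  rewrite word_rev all_map all_rev; apply: sub_all pc => s /=.
  by rewrite (label_parallel ef) commuting_sym => ?; rewrite commuting_sym commuting_inv.
- exists (p ++ q); first by rewrite edge_path_cat; exists (start f).
  by rewrite map_cat all_cat pc (label_parallel ef).
Qed.

(** [parallel_path] gives a path along the hyperplane whose letters commute with [l e]. Normalising
    it introduces no new letters, and the result is a shuffle of the word of [p]. *)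
Lemma parallel_reduced (e f : X 1) p : parallel e f ->
  edge_path (start e) p (start f) -> reduced (word p) ->
  all (commuting (l e)) (word p).
Proof.
move=> /parallel_path[q qe qc] pe rp; have := run_unique pe qe.
rewrite (run_nil rp) => /shuffle_perm/perm_all ->.
exact: (all_run HC qc).
Qed.

(** Between two crossings of one hyperplane, [parallel_reduced] applies to a piece of [p] that
    contains the first crossing edge, whose label would then commute with itself. *)
Lemma reduced_cross h p a b : edge_path a p b -> reduced (word p) -> cross h p <= 1.
Proof.
elim: p a => // e p IH a [ea pb] re.
have rp : reduced (word p) by case/andP: re.
rewrite /cross /=; case: asboolP => [he|_]; last exact: IH pb rp.
rewrite -/(cross h p) add1n ltnS leqNgt -has_count; apply/hasP => -[f fp /asboolP hf].
have ef := same_hyperplane_trans (same_hyperplane_sym he) hf.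
case/splitPr: fp pb re {rp IH} => p1 p2 /edge_path_cat[x p1x [fx _]].
rewrite -cat_rcons -cat_cons map_cat => /reduced_catl re.
case: ef => ef.
  have r1 : reduced (word (e :: p1)).
    by move: re; rewrite -rcons_cons -cats1 map_cat => /reduced_catl.
  have := parallel_reduced ef _ r1; rewrite fx => /(_ (conj erefl p1x)).
  by rewrite /= commuting_irr.
have := parallel_reduced ef _ re; rewrite start_rev => H.
have /H : edge_path (start e) (e :: rcons p1 f) (finish f).
  by split => //; apply/edge_path_rcons; rewrite fx.
by rewrite /= commuting_irr.
Qed.

Lemma cross_parity h a b (p q : seq (X 1)) : edge_path a p b -> edge_path a q b ->
  odd (cross h p) = odd (cross h q).
Proof.
move=> pab qab; have := cross_homotopic (edge_path_loop pab qab) h.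
rewrite /cross count_cat oddD -!/(cross _ _) cross_rev /=.
by case: (odd _) (odd _) => -[].
Qed.

(** A path avoiding [h] forces the crossing number of [p] to be even, and it is at most one. *)
Lemma reduced_halfspace h a b p : edge_path a p b -> reduced (word p) ->
  halfspace h a b <-> cross h p = 0.
Proof.
move=> pab rp; split=> [[q qab /crossP q0]|/crossP p0]; last by exists p.
have := cross_parity h pab qab; have := reduced_cross h pab rp; rewrite q0.
by case: (cross h p) => [|[]].
Qed.

Lemma mem_not_halfspace h a b p f : edge_path a p b -> reduced (word p) ->
  f \in p -> same_hyperplane h f -> ~ halfspace h a b.
Proof. by move=> pab rp fp hf /(reduced_halfspace h pab rp)/crossP/(_ f fp). Qed.

(** The letters before the crossing commute with [l e]. A crossing in the opposite direction is
    excluded, since the letter of [f] would have to commute with [l e], its own inverse. *)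
Lemma mem_pull e p b f : edge_path (start e) p b -> reduced (word p) ->
  f \in p -> same_hyperplane e f -> exists u, pull commuting (l e) (word p) = Some u.
Proof.
move=> pb rp fp ef; case/splitPr: fp pb rp => p1 p2 /edge_path_cat[x p1x /= [fx _]].
rewrite -fx in p1x; rewrite -cat_rcons => rp; case: ef => ef.
  have r1 : reduced (word p1).
    by move: rp; rewrite cat_rcons map_cat => /reduced_catl.
  rewrite cat_rcons map_cat (pull_cat HC) ?(parallel_reduced ef) //=.
  rewrite -(label_parallel ef) eqxx.
  by eexists.
move: rp; rewrite map_cat => /reduced_catl rp.
have := parallel_reduced ef _ rp; rewrite start_rev edge_path_rcons.
move=> /(_ (conj p1x erefl)); rewrite map_rcons all_rcons => /andP[].
have := label_parallel ef; rewrite label_rev => ->.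
by rewrite commuting_inv commuting_irr.
Qed.

(** Such an edge is the first edge of some geodesic to [o]: [p] crosses its hyperplane, and that
    crossing can be shuffled to the front. *)
Lemma descend o p e : edge_path (start e) p o -> reduced (word p) ->
  ~ halfspace e o (start e) -> exists2 q, edge_path (finish e) q o & size p = (size q).+1.
Proof.
move=> po rp oe.
have [f fp ef] : exists2 f, f \in p & same_hyperplane e f.
  apply: contrapT => nf; apply: oe; apply: halfspace_sym; exists p => // f fp ef.
  by apply: nf; exists f.
have [u /(pull_Some HC) pu] := mem_pull po rp fp ef.
have [q qo qw] := edge_path_shuffle pu po.
case: q qo qw => //= e' q [se qo] [le qu]; exists q; last first.
  by rewrite -(size_map l) (shuffle_size pu) -qu /= size_map.
by rewrite -(label_inj se le).
Qed.

(** Either [v] lies on a geodesic from [w] to [o], or [w] is of type 1 relative to [(o, v)]. In the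
    second case [reduced_cat] yields a cancellation at [v], and the cancelled edge gives the
    separating hyperplane. *)
Lemma halfspace_dichotomy o v w p q :
  edge_path w p v -> reduced (word p) -> edge_path v q o -> reduced (word q) ->
  reduced (word (p ++ q)) \/
  exists e, [/\ start e = v, ~ halfspace e o v & ~ halfspace e v w].
Proof.
move=> pwv rp qvo rq; rewrite map_cat; have [rpq|npq] := boolP (reduced (word p ++ word q));
  [by left|right].
have [s [w' [u' [qs ps]]]] := reduced_cat HC rp rq npq.
have [q' q'o q'w] := edge_path_shuffle qs qvo.
have [p' p'v p'w] := edge_path_shuffle ps pwv.
have rq' : reduced (word q') by rewrite q'w; exact: (reduced_shuffle HC qs rq).
have rp' : reduced (word p') by rewrite p'w; exact: (reduced_shuffle HC ps rp).
case: q' q'o q'w rq' => // e q' /[dup] q'o [ev _] [es _] rq'.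
case/lastP: p' p'v p'w rp' => [|p' f] /[dup] p'v.
  by move=> _ /(congr1 size); rewrite size_rcons.
move=> /edge_path_rcons[_ fv]; rewrite map_rcons => /rcons_inj[_ fs] rp'.
have fe : f = rev_edge e.
  rewrite -[f]rev_edgeK; congr rev_edge; apply: label_inj; first by rewrite start_rev fv.
  by rewrite label_rev fs label_invK.
exists e; split => // /halfspace_sym.
  apply: mem_not_halfspace q'o rq' _ (same_hyperplane_refl _).
  by rewrite inE eqxx.
apply: mem_not_halfspace p'v _ (_ : f \in _) _; rewrite ?map_rcons ?mem_rcons ?inE ?eqxx //.
by rewrite fe; apply/same_hyperplane_rev/same_hyperplane_refl.
Qed.

Lemma corner_square n (c : X n) i j : i != j -> square_corner (corner c i) (corner c j).
Proof.
move=> ij; have dinj : injectiveb [ffun k : 'I_2 => if k == ord0 then i else j].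
  apply/injectiveP => k m; rewrite !ffunE.
  by case: (ord2P k) (ord2P m) => -> [] -> //= /eqP; rewrite 1?[j == i]eq_sym (negPf ij).
exists (restr (Face (b0 n) dinj) c).
by rewrite /corner !cedge_restr face_vertex0 /= !ffunE.
Qed.

Lemma corner_same_hyperplane n (c : X n) i j :
  same_hyperplane (corner c i) (corner c j) -> i = j.
Proof.
have [//|/(corner_square c) /square_corner_commuting ij] := eqVneq i j.
by move=> [] /label_parallel E; move: ij; rewrite E ?label_rev ?commuting_inv commuting_irr.
Qed.

Definition edge_diag (e : X 1) : Defs.diagonal := existT (fun n => X n.+1) 0 e.

Lemma diag_edges_edge e : diag_edges (edge_diag e) = [:: e].
Proof. by rewrite /diag_edges /= enum_ordSl enum_ord0 /= corner_edge. Qed.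

Lemma diag_label_edge e : diag_label l (edge_diag e) = [set l e]%SET.
Proof. by rewrite /diag_label diag_edges_edge; apply/setP => s; rewrite !inE. Qed.

Lemma cube_path_edges v p w : edge_path v p w -> cube_path v (map edge_diag p) w.
Proof. by elim: p v => //= e p IH v [<- /IH]. Qed.

Lemma crossings_edges h p : crossings (map edge_diag p) h = cross h p.
Proof.
rewrite /crossings /cross; congr (count _ _); elim: p => //= e p ->.
by rewrite diag_edges_edge.
Qed.

Lemma crossings_rcons p d h :
  crossings (X := X) (rcons p d) h = crossings p h + cross h (diag_edges d).
Proof. by rewrite /crossings map_rcons flatten_rcons count_cat. Qed.

Lemma crossings_diag (h : X 1) d : cross h (diag_edges d) <= 1.
Proof.
case: d => n c; rewrite /cross /diag_edges /= count_map -size_filter.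
rewrite (_ : size _ = #|[pred i | `[< same_hyperplane h (corner c i) >]]|); last first.
  by rewrite cardE enumT; congr size; exact: eq_filter.
apply/card_le1_eqP => i j /asboolP hi /asboolP hj.
apply: (@corner_same_hyperplane _ c).
exact: same_hyperplane_trans (same_hyperplane_sym hj) hi.
Qed.

(** * Balls around the base point and local actions *)

Section BasePoint.
Variable o : X 0.

(* Paths are read from [w] towards [o], so that the letters which can be
   shuffled to the front of a reduced word are the descending edges at [w]. *)
Definition path_ball n : set (X 0) := [set w | exists2 p, edge_path w p o & size p <= n].

Definition path_sphere n : set (X 0) :=
  [set w | exists p, [/\ edge_path w p o, reduced (word p) & size p = n]].

Lemma ball_reduced n w : path_ball n w ->
  exists p, [/\ edge_path w p o, reduced (word p) & size p <= n].
Proof.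
move=> [p po pn]; have [q qo rq] := reduced_path_exists w o.
by exists q; split => //; exact: leq_trans (reduced_size qo po rq) pn.
Qed.

Lemma sphere_ball n w : path_sphere n w -> path_ball n w.
Proof. by move=> [p [po _ <-]]; exists p. Qed.

Lemma ball_le m n w : m <= n -> path_ball m w -> path_ball n w.
Proof. by move=> mn [p po pm]; exists p => //; exact: leq_trans pm mn. Qed.

Lemma ball_adjacent n (e : X 1) : path_ball n (start e) -> path_ball n.+1 (finish e).
Proof.
by move=> [p po pn]; exists (rev_edge e :: p) => //=; rewrite start_rev finish_rev.
Qed.

Lemma ballS n w : path_ball n.+1 w ->
  path_ball n w \/ exists2 e : X 1, path_sphere n (start e) & finish e = w.
Proof.
move=> /ball_reduced[p [po rp]]; rewrite leq_eqVlt ltnS => /orP[/eqP pn|pn]; last first.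
  by left; exists p.
case: p po rp pn => // e p [ew po] /andP[_ rp] [pn]; right; exists (rev_edge e).
  by rewrite start_rev; exists p.
by rewrite finish_rev.
Qed.

Lemma ball_finite n : exists L : seq (X 0), forall w, path_ball n w -> w \in L.
Proof.
elim: n => [|n [L LP]].
  by exists [:: o] => w [[|//] /= -> _]; rewrite inE.
(* By (A2) a vertex has at most one outgoing edge per label; [v] is the default where the label is
   missing. *)
pose nbr v s := xget v [set w | exists e, [/\ start e = v, l e = s & finish e = w]].
exists (L ++ [seq nbr v s | v <- L, s <- enum Sigma0]) => w /ballS[/LP wL|[e ev <-]].
  by rewrite mem_cat wL.
rewrite mem_cat; apply/orP; right; apply/allpairsP; exists (start e, l e).
rewrite /= mem_enum; split => //; first exact/LP/sphere_ball.
rewrite /nbr; case: xgetP => [_ -> [f [sf lf <-]]|/(_ (finish e))]; last by case; exists e.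
by rewrite (label_inj sf lf).
Qed.

(** The portrait of [k] at [v] on single labels, extended by the identity to labels absent at
    [v]. *)
Definition local_action (k : aut X) v s : Sigma0 :=
  xget s [set t | exists e, [/\ start e = v, l e = s & l (k 1 e) = t]].

Lemma local_actionE k e : local_action k (start e) (l e) = l (k 1 e).
Proof.
rewrite /local_action; case: xgetP => [_ -> [f [sf lf <-]]|/(_ (l (k 1 e)))].
  by rewrite (label_inj sf lf).
by case; exists e.
Qed.

Definition descending_labels v : {set Sigma0} :=
  [set s | `[< exists e, [/\ start e = v, l e = s & ~ halfspace e o v] >]]%SET.

(* For [A] the labels descending from [v], the last condition says that [g]
   fixes the vertices of type 1; unlike the type itself, it does not mention
   [o] and can be transported by label-preserving automorphisms. *)
Definition realizes v (A : {set Sigma0}) (sigma : Sigma0 -> Sigma0) (g : aut X) :=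
  [/\ g 0 v = v, forall e, start e = v -> l (g 1 e) = sigma (l e)
    & forall w, (exists e, [/\ start e = v, l e \in A & ~ halfspace e v w]) ->
        g 0 w = w].

Lemma realizes_conj v A sigma g (c : aut X) : (forall e, l (c 1 e) = l e) ->
  realizes v A sigma g -> realizes (c 0 v) A sigma (c * g * c^-1)%g.
Proof.
move=> cl [gv gl gA]; split=> [|e ev|w [e [ev eA ew]]].
- by rewrite !aut_mulE aut_invK gv.
- rewrite !aut_mulE cl -[e in RHS](aut_invKV c) cl; apply: gl.
  by rewrite -cmap_start ev aut_invK.
- rewrite !aut_mulE gA ?aut_invKV //; exists ((c^-1)%g 1 e); split.
  + by rewrite -cmap_start ev aut_invK.
  + by rewrite -cl aut_invKV.
  + by move/(aut_halfspace c); rewrite !aut_invKV.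
Qed.

Lemma local_action_morphism (k : aut X) v :
  k 0 v = v -> label_morphism l v (local_action k v).
Proof.
move=> kv; split=> s t /[!in_setE] -[e ev <-] -[f fv <-].
  rewrite -[in local_action _ _ (l e)]ev -[in local_action _ _ (l f)]fv !local_actionE.
  move=> kef; congr l; apply: (@aut_inj _ k); apply: label_inj kef.
  by rewrite -!cmap_start ev fv.
rewrite -[in local_action _ _ (l e)]ev -[in local_action _ _ (l f)]fv !local_actionE.
rewrite !labels_commuteE; split=> H.
  have [] := commuting_square _ H; first by rewrite ev fv.
  by move=> c [<- <-]; rewrite /corner !cmap_cedge; exact: commuting_cedge.
have [] := commuting_square _ H; first by rewrite -!cmap_start ev fv.
move=> c [ce cf]; rewrite -(aut_invK k e) -(aut_invK k f) -ce -cf.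
by rewrite /corner !cmap_cedge; exact: commuting_cedge.
Qed.

(** The edge [e] ends at distance [n - 1] from [o]. If [f] spans a square with [e], the side
    opposite to [f] starts there and so lies in the fixed ball; its label is that of [f]. *)
Lemma fixed_near_descending (k : aut X) n e f : (forall w, path_ball n w -> k 0 w = w) ->
  path_sphere n (start e) -> ~ halfspace e o (start e) -> start f = start e ->
  f = e \/ commuting (l e) (l f) -> k 1 f = f.
Proof.
move=> kn en oe fe.
have [q qo qn] : exists2 q, edge_path (finish e) q o & (size q).+1 = n.
  have [p [po rp <-]] := en; have [q qo ->] := descend po rp oe; by exists q.
have en1 : path_ball n (finish e) by exists q => //; rewrite -qn.
case=> [->|/(commuting_square (esym fe))[c ce]].
  by apply: edge_rigid; rewrite -?cmap_start -?cmap_finish kn //; exact: sphere_ball.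
have /square_sides[e' [f' [_ pf _ sf' _]]] : square_corner e f by exists c.
have kf' : k 1 f' = f'.
  have f'n : path_ball n (finish f').
    by rewrite -qn; apply: ball_adjacent; rewrite sf'; exists q.
  by apply: edge_rigid; rewrite -?cmap_start -?cmap_finish kn // sf'.
apply: label_inj; first by rewrite -cmap_start fe kn //; exact: sphere_ball.
by rewrite (label_parallel (cmap_parallel k pf)) kf' (label_parallel pf).
Qed.

(** If appending [alpha] makes the word reducible, some corner edge of the diagonal is descending.
    The other letters of [alpha], and all letters commuting with [alpha], commute with its label, so
    [fixed_near_descending] applies. *)
Lemma local_action_compatible (k : aut X) n v p : (forall w, path_ball n w -> k 0 w = w) ->
  edge_path v p o -> reduced (word p) -> size p = n ->
  compatible l o (word_of l (map edge_diag (rev_edges p))) v (local_action k v).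
Proof.
move=> kn pv rp pn alpha [d dv dl] [_ nred].
have vn : path_sphere n v by exists p.
(* The path and the diagonal each cross a hyperplane at most once; if no corner edge descended, they
   would share none and the extended path would be reduced. *)
have [i oi] : exists i, ~ halfspace (corner (projT2 d) i) o v.
  apply: contrapT => no; apply: nred.
  exists (rcons (map edge_diag (rev_edges p)) d); split.
  - exists (diag_end d).
    elim: (rev_edges p) o (edge_path_rev pv) => /= [a -> //|e q IH a [ea qv]].
    by split => //; exact: IH qv.
  - by rewrite /word_of map_rcons dl.
  - move=> h; rewrite crossings_rcons crossings_edges cross_rev.
    have := reduced_cross h pv rp; have := crossings_diag h d.
    case E: (cross h (diag_edges d)) => [|[|//]] _; first by rewrite addn0.
    case F: (cross h p) => [|[|//]] _ //; exfalso; apply: no.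
    have /hasP[f] : has (fun f => `[< same_hyperplane h f >]) (diag_edges d).
      by rewrite has_count -/(cross _ _) E.
    move=> /mapP[i _ ->] /asboolP hi; exists i => /halfspace_sym.
    have /hasP[f' fp /asboolP hf] : has (fun f => `[< same_hyperplane h f >]) p.
      by rewrite has_count -/(cross _ _) F.
    apply: mem_not_halfspace pv rp fp _.
    exact: same_hyperplane_trans (same_hyperplane_sym hi) hf.
set e := corner (projT2 d) i in oi.
have ev : start e = v by rewrite start_cedge.
have lfix f : start f = v -> f = e \/ commuting (l e) (l f) -> local_action k v (l f) = l f.
  move=> fv fe; rewrite -{1}fv local_actionE (fixed_near_descending kn _ _ _ fe) ?ev //.
have ea : l e \in alpha.
  by rewrite -dl inE; apply/map_f/map_f; rewrite mem_enum.
split=> [s|beta [d' dv' dl'] ab s sb].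
  rewrite -dl inE => /mapP[_ /mapP[j _ ->] ->]; apply: lfix; first by rewrite start_cedge.
  have [<-|ij] := eqVneq i j; first by left.
  by right; apply/square_corner_commuting/corner_square.
have := sb; rewrite -dl' inE => /mapP[_ /mapP[j _ ->] sE]; rewrite sE.
apply: lfix; first by rewrite start_cedge.
by right; apply/labels_commuteE/ab => //; rewrite -sE.
Qed.

(** A vertex [w] that is not of type 1 has a geodesic to [o] through [v]. Inside the ball of radius
    [n + 1] it is then [v] or a neighbour of [v]. *)
Lemma realizes_ball n v sigma (g : aut X) : path_sphere n v ->
  realizes v (descending_labels v) sigma g ->
  forall w, path_ball n.+1 w -> (forall e : X 1, start e = v -> finish e <> w) -> g 0 w = w.
Proof.
move=> [q [qo rq qn]] [gv gl gA] w [p pw pn] nadj.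
have [x xv rx] := reduced_path_exists w v.
have [rxq|[e [ev oe ew]]] := halfspace_dichotomy xv rx qo rq; last first.
  by apply: gA; exists e; split => //; rewrite inE; apply/asboolP; exists e.
have xq : edge_path w (x ++ q) o by apply/edge_path_cat; exists v.
have := leq_trans (reduced_size xq pw rxq) pn.
rewrite size_cat qn -(add1n n) leq_add2r.
case: x xv {rx rxq xq} => [|e [|//]] /=; first by move=> ->.
move=> [ew ev] _; case: (nadj (rev_edge e)).
  by rewrite start_rev.
by rewrite finish_rev.
Qed.

Hypothesis app : forall (u : seq {set Sigma0}) (v : X 0),
  spells l o u v -> reduced_word l o u -> u <> [::] ->
  forall sigma : Sigma0 -> Sigma0,
    label_morphism l v sigma -> compatible l o u v sigma -> appears l o v sigma.

Lemma realizes_exists (k : aut X) n v : 0 < n -> (forall w, path_ball n w -> k 0 w = w) ->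
  path_sphere n v -> exists g, realizes v (descending_labels v) (local_action k v) g.
Proof.
move=> n0 kn /[dup] vn [p [pv rp pn]].
pose pc := map edge_diag (rev_edges p).
have pcv : cube_path o pc v by apply/cube_path_edges/edge_path_rev.
have [|||||g [go gl gw]] := @app (word_of l pc) v _ _ _ (local_action k v).
- by exists pc.
- exists pc; split => //; first by exists v.
  by move=> h; rewrite crossings_edges cross_rev; exact: reduced_cross pv rp.
- by move/(congr1 size); rewrite !size_map size_rev pn; case: (n) n0.
- exact/local_action_morphism/kn/sphere_ball.
- exact: local_action_compatible kn pv rp pn.
exists g; split.
(* The vertex [v] lies in the carrier of the hyperplane dual to the first edge towards [o], so it is
   of type 1 or 2 and [g] fixes it; [0 < n] provides that edge. *)
- case: p pv rp pn {pc pcv} => [|e p] /=; first by move=> _ _ n0'; rewrite -n0' in n0.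
  move=> [ev po] rp pn; have oe : ~ halfspace e o v.
    move/halfspace_sym; apply: (@mem_not_halfspace e v o (e :: p) e) => //=.
      by rewrite inE eqxx.
    exact: same_hyperplane_refl.
  apply: gw; have [tv|?] :=
    pselect (forall h, adjacent_separating o v h -> halfspace h v v); [right|by left].
  split => //; exists e => //; exists 1, e; split.
    by exists (b0 1); rewrite -ev.
  exists (idface 1); rewrite restr_id; exact: same_hyperplane_refl.
- move=> e ev; have := gl (edge_diag e) ev; rewrite diag_label_edge.
  rewrite (_ : diag_image g _ = edge_diag (g 1 e)) // diag_label_edge imset_set1.
  by move/set1_inj.
- move=> w [e [ev]]; rewrite inE => /asboolP[f [fv fe of_]] ew; apply: gw; left => H.
  by apply: ew; rewrite -(@label_inj f e) ?fv //; apply: H.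
Qed.

(** * Approximating stabilizer elements ball by ball *)

Section Approximation.
Variable H : set (aut X).
Hypothesis H1 : H 1%g.
Hypothesis HM : forall g h, H g -> H h -> H (g * h)%g.
Hypothesis H_start : forall k : aut X, k 0 o = o ->
  exists h, [/\ H h, h 0 o = o & forall e, start e = o -> h 1 e = k 1 e].
Hypothesis H_realizes : forall v sigma,
  (exists g, realizes v (descending_labels v) sigma g) ->
  exists2 g, H g & realizes v (descending_labels v) sigma g.

(** The vertices of [L] are corrected in turn. The factor [g] for [v] fixes each vertex of the ball
    of radius [n + 1] that the remaining discrepancy [k'] fixes, so earlier corrections survive. *)
Lemma sphere_approx (k : aut X) n (L : seq (X 0)) :
  0 < n -> (forall w, path_ball n w -> k 0 w = w) ->
  exists h, [/\ H h, forall w, path_ball n w -> h 0 w = w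
    & forall e : X 1, start e \in L -> path_sphere n (start e) ->
        h 0 (finish e) = k 0 (finish e)].
Proof.
move=> n0 kn; elim: L => [|v L [h [Hh hn hL]]]; first by exists 1%g; split.
have [vn|vn] := pselect (path_sphere n v); last first.
  exists h; split => // e; rewrite inE => /orP[/eqP ->//|]; exact: hL.
pose k' : aut X := (h^-1 * k)%g.
have k'n w : path_ball n w -> k' 0 w = w.
  by move=> wn; rewrite aut_mulE kn // -{1}(hn _ wn) aut_invK.
have [g Hg gv] := H_realizes (realizes_exists n0 k'n vn).
have gk (e : X 1) : start e = v -> g 0 (finish e) = k' 0 (finish e).
  move=> ev; rewrite !cmap_finish; congr finish; have [gvv gl _] := gv; apply: label_inj.
    by rewrite -!cmap_start ev gvv k'n //; exact: sphere_ball.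
  by rewrite gl // -{1}ev local_actionE.
have gfix w : path_ball n.+1 w -> k' 0 w = w -> g 0 w = w.
  move=> wn kw.
  have [[e ev ew]|nadj] := pselect (exists2 e : X 1, start e = v & finish e = w).
    by rewrite -ew gk // ew.
  by apply: (realizes_ball vn gv) => // e ev ew; apply: nadj; exists e.
exists (h * g)%g; split; first exact: HM.
  by move=> w wn; rewrite aut_mulE gfix ?hn ?k'n //; exact: ball_le wn.
move=> e; rewrite inE => /orP[/eqP ev _|eL en].
  by rewrite aut_mulE gk // aut_mulE aut_invKV.
rewrite aut_mulE gfix ?hL //; first exact/ball_adjacent/sphere_ball.
by rewrite aut_mulE -hL // aut_invK.
Qed.

Lemma stabilizer_approx (k : aut X) n : k 0 o = o ->
  exists2 h, H h & forall w, path_ball n w -> h 0 w = k 0 w.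
Proof.
(* The induction starts at radius 1, where [H_start] is used: local actions are only known to appear
   at vertices other than [o]. *)
move=> ko; suff [h Hh hn] : exists2 h, H h & forall w, path_ball n.+1 w -> h 0 w = k 0 w.
  by exists h => // w wn; apply: hn; exact: ball_le wn.
elim: n => [|n [h Hh hn]].
  have [h [Hh ho he]] := H_start ko; exists h => // w.
  move=> /ballS[[p + /[!leqn0]/nilP p0]|[e [p [+ _ /size0nil p0]] <-]];
    rewrite {}p0 /= => eo; first by rewrite eo ho ko.
  by rewrite !cmap_finish he.
have k'n w : path_ball n.+1 w -> (h^-1 * k)%g 0 w = w.
  by move=> wn; rewrite aut_mulE -hn // aut_invK.
have [L LP] := ball_finite n.+1.
have [g [Hg gn gL]] := sphere_approx (k := (h^-1 * k)%g) (n := n.+1) L isT k'n.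
exists (h * g)%g; first exact: HM.
move=> w /ballS[wn|[e en <-]]; first by rewrite aut_mulE gn // hn.
by rewrite aut_mulE gL // ?aut_mulE ?aut_invKV //; exact/LP/sphere_ball.
Qed.

End Approximation.
End BasePoint.
End LabelledComplex.

(** * Deck transformations *)

Lemma start_vertex (K : cubeComplex) (v : K 0) : start v = v.
Proof.
by rewrite -[RHS]restr_id /start /cvert; congr restr; apply: face_eq => -[].
Qed.

Section DeckTransformations.
Context {K L : cubeComplex} (p : cubeMap K L).
Hypothesis coverp : covering p.
Hypothesis simplyK : simply_connected K.

Lemma covering_inj n (c d : K n) : start c = start d -> p n c = p n d -> c = d.
Proof.
move=> scd pcd; have [|e [_ eu]] := coverp.2 (start d) n (p n d).
  by rewrite -cmap_start.
by rewrite -(eu c) ?(eu d).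
Qed.

(** The lift, starting at [v], of the image of [c] in [L], for [v] in the fibre of [start c]. *)
Definition lift_cell n (v : K 0) (c : K n) : K n :=
  xget c [set d | start d = v /\ p n d = p n c].

Lemma liftP n v (c : K n) : p 0 v = p 0 (start c) ->
  start (lift_cell v c) = v /\ p n (lift_cell v c) = p n c.
Proof.
move=> pv; rewrite /lift_cell; case: xgetP => [d _ //|H]; exfalso.
have [|d [dP _]] := coverp.2 v n (p n c); first by rewrite -cmap_start.
exact: H dP.
Qed.

Lemma liftE n v (c d : K n) : start d = v -> p n d = p n c -> lift_cell v c = d.
Proof.
move=> dv pd; have [|sl pl] := @liftP _ v c; first by rewrite -dv !cmap_start pd.
by apply: covering_inj; rewrite ?sl ?pl.
Qed.

(** Endpoint of the lift to [v] of the projected path. *)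
Definition transport (v : K 0) (q : seq (K 1)) : K 0 :=
  foldl (fun v e => finish (lift_cell v e)) v q.

Lemma transport_fiber a b q v : edge_path a q b -> p 0 v = p 0 a ->
  p 0 (transport v q) = p 0 b.
Proof.
elim: q a v => [|e q IH] a v /=; first by move->.
move=> [<- qb] pv; apply: IH qb _; have [_ pl] := liftP pv.
by rewrite !cmap_finish pl.
Qed.

Lemma transport_cat v q r : transport v (q ++ r) = transport (transport v q) r.
Proof. exact: foldl_cat. Qed.

(** Homotopy lifting: backtracks lift to backtracks, and the two ways around a square lift to the
    two ways around its lift. *)
Lemma transport_homotopic a b q r : homotopic a b q r ->
  forall v, p 0 v = p 0 a -> transport v q = transport v r.
Proof.
elim=> {q r}[q r [qab _ qr]|//|x y _ IH|x y z _ IH1 _ IH2] v va; first last.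
- by rewrite IH1 ?IH2.
- by rewrite IH.
case: qr qab => {q r} q r.
  move=> e /edge_path_cat[x qx /= [ex _]]; rewrite !transport_cat /=.
  have pe : p 0 (transport v q) = p 0 (start e) by rewrite (transport_fiber qx va) ex.
  move: (transport v q) pe => w pe; have [sl pl] := liftP pe.
  rewrite (@liftE _ _ (rev_edge e) (rev_edge (lift_cell w e))).
  - by rewrite finish_rev sl.
  - exact: start_rev.
  - by rewrite !cmap_rev pl.
move=> c b1 b2 /edge_path_cat[x qx [ex _]]; rewrite !transport_cat /=.
have pe : p 0 (transport v q) = p 0 (start c).
  by rewrite (transport_fiber qx va) -ex start_cedge.
move: (transport v q) pe => w pe; have [sl pl] := liftP pe.
have le i b' w' : cvert b' (lift_cell w c) = w' ->
    finish (lift_cell w' (cedge i b' c)) = cvert (flip i b') (lift_cell w c).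
  move=> <-; rewrite (@liftE _ _ _ (cedge i b' (lift_cell w c))) ?finish_cedge //.
    by rewrite start_cedge.
  by rewrite !cmap_cedge pl.
have b1E : b1 = flip ord0 (b0 2) by apply/ffunP => i; rewrite !ffunE.
have b2E : b2 = flip ord_max (b0 2) by apply/ffunP => i; rewrite !ffunE.
by rewrite !(le _ (b0 2)) // b1E b2E !le // flipC.
Qed.

Lemma transport_rev a b q v : edge_path a q b -> p 0 v = p 0 a ->
  transport (transport v q) (rev_edges q) = v.
Proof.
move=> qab va; rewrite -transport_cat; apply: (@transport_homotopic a a _ [::]) => //.
by apply: simplyK.2; rewrite edge_path_cat; exists b => //; exact: edge_path_rev.
Qed.

Lemma transport_unique a b q r v : edge_path a q b -> edge_path a r b ->
  p 0 v = p 0 a -> transport v q = transport v r.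
Proof.
move=> qab rab va; have pb := transport_fiber qab va.
have := @transport_homotopic b b (rev_edges q ++ r) [::] _ _ pb.
rewrite transport_cat (transport_rev qab) // => -> //.
by apply: simplyK.2; rewrite edge_path_cat; exists a => //; exact: edge_path_rev.
Qed.

Section Lift.
Variables (x y : K 0).
Hypothesis xy : p 0 y = p 0 x.

(** The lift of [p] through itself that sends [x] to [y]; simple connectivity makes it independent
    of the chosen path. *)
Definition vertex_lift (v : K 0) : K 0 := transport y (projT1 (cid (simplyK.1 x v))).

Lemma vertex_liftE v q : edge_path x q v -> vertex_lift v = transport y q.
Proof.
by move=> qv; rewrite /vertex_lift; case: cid => r /= rv; exact: transport_unique rv qv xy.
Qed.

Lemma vertex_lift_fiber v : p 0 (vertex_lift v) = p 0 v.
Proof.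
by rewrite /vertex_lift; case: cid => r /= rv; exact: transport_fiber rv xy.
Qed.

Lemma vertex_lift_finish (e : K 1) :
  vertex_lift (finish e) = finish (lift_cell (vertex_lift (start e)) e).
Proof.
have [q qe] := simplyK.1 x (start e).
rewrite (vertex_liftE qe) (@vertex_liftE _ (rcons q e)); last exact/edge_path_rcons.
by rewrite -cats1 transport_cat.
Qed.

Definition cell_lift n (c : K n) : K n := lift_cell (vertex_lift (start c)) c.

Lemma cell_liftP n (c : K n) :
  start (cell_lift c) = vertex_lift (start c) /\ p n (cell_lift c) = p n c.
Proof. by apply: liftP; rewrite vertex_lift_fiber. Qed.

(** Walk from the start of the cube to its vertex [b] along edges, by induction on the number of
    true coordinates of [b]. *)
Lemma cvert_cell_lift n b (c : K n) : cvert b (cell_lift c) = vertex_lift (cvert b c).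
Proof.
have [sl pl] := cell_liftP c.
have [m] := ubnP #|[pred i | b i]|; elim: m b => // m IH b bm.
case: (pickP [pred i | b i]) => [i /= bi|bF]; last first.
  by rewrite (_ : b = b0 n) //; apply/ffunP => i; rewrite ffunE; exact: bF.
have vi : cvert (flip i b) (cell_lift c) = vertex_lift (cvert (flip i b) c).
  apply: IH; rewrite -ltnS; apply: leq_trans bm; rewrite ltnS; apply/proper_card/properP.
  split; last by exists i => //=; rewrite !inE ffunE eqxx bi.
  apply/fintype.subsetP => j; rewrite !inE ffunE.
  have [->|_] := eqVneq j i; first by rewrite bi.
  by rewrite addbF.
have -> : b = flip i (flip i b) by rewrite flipK.
rewrite -!finish_cedge vertex_lift_finish start_cedge; congr finish.
by apply/esym/liftE; rewrite ?start_cedge // !cmap_cedge pl.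
Qed.

Lemma cell_lift_restr m n (f : face m n) (c : K n) :
  cell_lift (restr f c) = restr f (cell_lift c).
Proof.
have [_ pl] := cell_liftP c; apply: liftE; rewrite ?cmap_restr ?pl //.
by rewrite !start_restr cvert_cell_lift.
Qed.

Definition map_lift : cubeMap K K := CubeMap cell_lift_restr.

Lemma map_lift_base : map_lift 0 x = y.
Proof.
have [+ _] := cell_liftP x; rewrite !start_vertex => /= ->.
by rewrite (@vertex_liftE x [::]).
Qed.

End Lift.

Lemma covering_rigid (h : cubeMap K K) v : (forall n c, p n (h n c) = p n c) ->
  h 0 v = v -> forall n c, h n c = c.
Proof.
move=> ph hv; have h0 w : h 0 w = w.
  have [q] := simplyK.1 v w; elim: q v hv => [|e q IH] v hv /=; first by move<-.
  move=> [ev]; apply: IH; rewrite cmap_finish (@covering_inj _ (h 1 e) e) //.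
  by rewrite -cmap_start ev.
by move=> n c; apply: covering_inj => //; rewrite -cmap_start.
Qed.

(** The lifts exchanging the roles of [x] and [y] are mutually inverse by uniqueness of lifts. *)
Lemma deck_transitive x y : p 0 x = p 0 y -> exists2 g, deck p g & g 0 x = y.
Proof.
move=> pxy; have pyx := esym pxy.
pose f := map_lift pyx; pose f' := map_lift pxy.
have pf n c : p n (f n c) = p n c by case: (cell_liftP pyx c).
have pf' n c : p n (f' n c) = p n c by case: (cell_liftP pxy c).
have fx : f 0 x = y := map_lift_base pyx.
have f'y : f' 0 y = x := map_lift_base pxy.
move: f f' pf pf' fx f'y => f f' pf pf' fx f'y.
have ff' n : cancel (f n) (f' n).
  by apply: (@covering_rigid (compmap f' f) x) => [k c|] /=; rewrite ?pf' ?pf ?fx.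
have f'f n : cancel (f' n) (f n).
  by apply: (@covering_rigid (compmap f f') y) => [k c|] /=; rewrite ?pf' ?pf ?f'y.
by exists (Aut ff' f'f).
Qed.

End DeckTransformations.

(** * Open stars and the compact-open topology *)

Lemma reflectK (K : cubeComplex) n b (c : K n) :
  restr (reflface b) (restr (reflface b) c) = c.
Proof.
rewrite -restr_comp -[RHS]restr_id; congr restr; apply: face_eq => i; rewrite !ffunE //.
have /ffunP/(_ i) := face_vertex_reflface b b.
by rewrite !ffunE addbb.
Qed.

Section OpenStars.
Context (R : realType) (K : cubeComplex).
Local Open Scope ring_scope.

(* Every face of the cube that contains [x] contains the vertex [b]. *)
Definition near_vertex n (b : {ffun 'I_n -> bool}) (x : unit_cube R n) : Prop :=
  forall i, if b i then 0 < set_val x ord0 i else set_val x ord0 i < 1.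

Definition cell_star (v : K 0) : set (cell_point R K) :=
  [set z | let: existT n cx := z in
     exists2 b, cvert b (cx.1 : K n) = v & near_vertex b cx.2].

(** In the directions normal to the face, the coordinate of [y] is 0 or 1, which forces [b] to agree
    with [base f] there; so [b] is a vertex of the face. *)
Lemma cell_star_glue1 v z z' : face_glue1 z z' -> cell_star v z <-> cell_star v z'.
Proof.
case=> m n f c x y yf.
have yE i : set_val y ord0 i = let z := place 0 f (set_val x ord0) i in
    if base f i then 1 - z else z by rewrite yf mxE.
split=> -[b /= bv bx].
  exists (face_vertex f b) => /=; first by rewrite -cvert_restr.
  move=> i; rewrite yE ffunE /place; case: pickP => [k _|_] /=.
    have := bx k; case: (base f i) (b k) => -[] /=; rewrite ?addbT ?addbF /=;
      by rewrite ?subr_gt0 // ltrBlDr ltrDl.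
  by case: (base f i); rewrite /= ?subr0 ?ltr01.
have bE : b = face_vertex f [ffun k => base f (dir f k) (+) b (dir f k)].
  apply/ffunP => i; have := bx i; rewrite yE ffunE /place.
  case: pickP => [k /eqP <- _|_] /=; first by rewrite ffunE addKb.
  by case: (base f i) (b i) => -[]; rewrite ?subr0 ?ltxx.
exists [ffun k => base f (dir f k) (+) b (dir f k)] => /=.
  by rewrite cvert_restr -bE.
move=> k; have := bx (dir f k); rewrite yE /place ffunE.
case: pickP => [j /eqP/(injectiveP _ (dir_inj f)) ->|/(_ k)]; last by rewrite eqxx.
by case: (base f _) (b _) => -[] /=; rewrite ?subr_gt0 // ltrBlDr ltrDl.
Qed.

Lemma cell_star_glue v z z' : face_glue z z' -> cell_star v z <-> cell_star v z'.
Proof.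
move/asboolP; elim=> [x y|x|x y _ xy|x y t _ xy _ yt] //.
- exact: cell_star_glue1.
- by rewrite xy.
- by rewrite xy.
Qed.

Definition star (v : K 0) : set (realization R K) := [set z | cell_star v (repr z)].

Lemma star_pi v (z : cell_point R K) :
  star v (\pi_(realization R K) z)%qT <-> cell_star v z.
Proof.
apply: cell_star_glue; rewrite -eqmodE; apply/eqP.
exact: (reprK (\pi_(realization R K) z)%qT).
Qed.

Lemma open_near_vertex n (b : {ffun 'I_n -> bool}) : open [set x | near_vertex b x].
Proof.
pose D i : set R := if b i then [set t | 0 < t] else [set t | t < 1].
have -> : [set x | near_vertex b x] =
    \bigcap_(i in [set: 'I_n]) (fun x : unit_cube R n => set_val x ord0 i) @^-1` D i.
  apply/seteqP; split=> x H i => [_|]; have := H i; rewrite /D /=.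
    by case: (b i).
  by move=> /(_ Logic.I); case: (b i).
rewrite openE => x Dx.
suff : nbhs x [set y : unit_cube R n | forall i, D i (set_val y ord0 i)].
  by apply: filterS => y H i _; exact: H.
apply: (@filter_forall _ _ (fun i (y : unit_cube R n) => D i (set_val y ord0 i))
  (nbhs x)) => i.
have oD : open (D i) by rewrite /D; case: (b i); [exact: open_gt|exact: open_lt].
have cont : continuous (fun y : unit_cube R n => set_val y ord0 i).
  move=> y; apply: (@continuous_comp _ _ _ _ (fun M : 'rV[R]_n => M ord0 i)).
    exact: initial_continuous.
  exact: coord_continuous.
by apply: cont; apply: open_nbhs_nbhs; split => //; exact: Dx.
Qed.

Lemma open_star v : open (star v).
Proof.
apply/sigT_openP => n.
have -> : existT _ n @^-1` (\pi_(realization R K)%qT @^-1` star v) =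
    \bigcup_(b in [set b : {ffun 'I_n -> bool} | True])
      ((fst @^-1` [set c : discrete_topology (K n) | cvert b (c : K n) = v]) `&`
       (snd @^-1` [set x : unit_cube R n | near_vertex b x])).
  apply/seteqP; split=> -[c x] /=.
    by move=> /star_pi[b bv bx]; exists b.
  by move=> [b _ [bv bx]]; apply/star_pi; exists b.
apply: bigcup_open => b _; apply: openI; apply: open_comp.
- by move=> cx _; exact: cvg_fst.
- exact: discrete_open.
- by move=> cx _; exact: cvg_snd.
- exact: open_near_vertex.
Qed.

Lemma star_cover z : exists v, star v z.
Proof.
rewrite -[z]reprK; move: (repr z) => [n [c x]].
exists (cvert [ffun i => 0 < set_val x ord0 i] (c : K n)); apply/star_pi.
exists [ffun i => 0 < set_val x ord0 i] => // i; rewrite ffunE.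
by case: ltP => // /le_lt_trans; apply; exact: ltr01.
Qed.

(** If finitely many stars never sufficed, the complements of finite unions of stars in [A] would
    generate a proper filter, whose cluster point lies in some open star. *)
Lemma compact_stars (A : set (realization R K)) : compact A ->
  exists L : seq (K 0), forall z, A z -> exists2 v, v \in L & star v z.
Proof.
move=> cA; apply: contrapT => nL.
pose F : set_system (realization R K) := [set P | exists L : seq (K 0),
  forall z, A z -> (forall v, v \in L -> ~ star v z) -> P z].
have FF : ProperFilter F.
  split=> [[L LP]|].
    apply: nL; exists L => z Az; apply: contrapT => nz.
    by apply: (LP z) => // v vL vz; apply: nz; exists v.
  split=> [|P Q [L LP] [L' LQ]|P Q PQ [L LP]].
  - by exists [::].
  - exists (L ++ L') => z Az zL; split; [apply: LP|apply: LQ] => // v vL;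
      by apply: zL; rewrite mem_cat vL ?orbT.
  - by exists L => z Az zL; apply: PQ; exact: LP.
have FA : F A by exists [::].
have [z [Az zF]] := cA F FF FA.
have [v vz] := star_cover z.
have [|t [nt vt]] := zF (~` star v) (star v) _ (open_nbhs_nbhs (conj (@open_star v) vz)).
  by exists [:: v] => t _; apply; rewrite inE.
exact: nt vt.
Qed.

(** A vertex lies in no open star but its own. *)
Lemma compact_finite_vertices : compact [set: realization R K] ->
  exists L : seq (K 0), forall v, v \in L.
Proof.
move=> /compact_stars[L LP]; exists L => v.
have x0P : (0 : 'rV[R]_0) \in unit_cube R 0 by apply/mem_set => -[].
have [//|w wL /star_pi[b /= bw _]] :=
  LP (\pi_(realization R K) (mk_point v (exist _ 0 x0P)))%qT.
rewrite -(start_vertex v) /start (_ : b0 0 = b) ?bw //.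
by apply/ffunP => -[].
Qed.

End OpenStars.

Section Density.
Context (R : realType) (X : cubeComplex).

Lemma realize_map_star (g h : aut X) v :
  (forall n b (c : X n), cvert b c = v -> g n c = h n c) ->
  forall z : realization R X, star v z -> realize_map g z = realize_map h z.
Proof.
move=> gh z; rewrite /star /realize_map /=.
by case: (repr z) => n [c x] /= [b bv _]; rewrite (gh n b).
Qed.

(** A compact set lies in finitely many stars, and on the star of [v] a realized map depends only on
    the cells containing [v]. So the filter [F] of agreement with [g] near finite vertex sets
    converges to [g]. *)
Lemma dense_aut_top (H : set (aut X)) :
  (forall (g : aut X) (L : seq (X 0)), exists2 h, H h &
     forall n b (c : X n), cvert b c \in L -> h n c = g n c) ->
  dense (H : set (aut_top R X)).
Proof.
move=> HP O [g Og] [A oA AO].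
pose F : set_system {compact-open, realization R X -> realization R X} :=
  [set P | exists L : seq (X 0), forall h : aut X,
    (forall n b (c : X n), cvert b c \in L -> h n c = g n c) -> P (realize_map h)].
have FF : Filter F.
  split=> [|P Q [L LP] [L' LQ]|P Q PQ [L LP]].
  - by exists [::].
  - exists (L ++ L') => h hL; split; [apply: LP|apply: LQ] => n b c cL;
      by apply: (hL n b); rewrite mem_cat cL ?orbT.
  - by exists L => h hL; apply/PQ/LP.
have : F --> (realize_map g : {compact-open, realization R X -> realization R X}).
  apply/compact_open_cvgP => K U /compact_stars[L LP] _ gU; exists L => h hL.
  move=> _ [z Kz <-]; have [v vL vz] := LP z Kz.
  rewrite (@realize_map_star h g v) //.
    by apply: gU; exists z.
  by move=> n b c cv; apply: (hL n b); rewrite cv.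
have Ag : nbhs (realize_map g : {compact-open, realization R X -> realization R X}) A.
  by apply: open_nbhs_nbhs; split => //; rewrite -AO in Og.
move=> /(_ _ Ag)[L LA]; have [h Hh hL] := HP g L.
by exists h; split => //; rewrite -AO; exact: LA.
Qed.

End Density.

(** * Generators of a dense subgroup *)

Lemma covering_simplicial_links (K L : cubeComplex) (p : cubeMap K L) :
  covering p -> simplicial_links (K := L) -> simplicial_links (K := K).
Proof.
move=> coverp [Linj Luniq]; split=> [n c i j cij|n c d scd ccd].
  by apply: (Linj n (p n c)); rewrite /corner -!cmap_cedge -!/(corner _ _) cij.
apply: (covering_inj coverp) => //; apply: Luniq; first by rewrite -!cmap_start scd.
by move=> i; rewrite /corner -!cmap_cedge -!/(corner _ _) ccd.
Qed.

Lemma smallest_subgroup (G : groupType) (A : set G) : subgroup (smallest (@subgroup G) A).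
Proof.
split=> [|x y /set_mem xA /set_mem yA]; apply/mem_set => M [MG AM].
  by have [/set_mem] := MG.
by apply/set_mem; apply: MG.2; apply/mem_set; [apply: xA|apply: yA].
Qed.

Lemma subgroupM (G : groupType) (H : set G) x y : subgroup H -> H x -> H y -> H (x * y)%g.
Proof. by move=> /group_closedM HM Hx Hy; apply/set_mem/HM; exact/mem_set. Qed.

Lemma subgroupV (G : groupType) (H : set G) x : subgroup H -> H x -> H (x^-1)%g.
Proof. by move=> /group_closedV HV Hx; apply/set_mem/HV; exact/mem_set. Qed.

Lemma subgroup1 (G : groupType) (H : set G) : subgroup H -> H 1%g.
Proof. by move=> [/set_mem]. Qed.

Section Generators.
Context (S X : cubeComplex) (p : cubeMap X S) (Sigma0 : finType).
Variables (inv : Sigma0 -> Sigma0) (l : X 1 -> Sigma0) (o : X 0).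
Hypothesis linksS : simplicial_links (K := S).
Hypothesis universalp : universal_covering p.
Hypothesis adml : admissible inv l.
Hypothesis invl : invariant_labeling (deck p) l.
Variable (vertS : seq (S 0)).
Hypothesis vertSP : forall w, w \in vertS.

Let linksX : simplicial_links (K := X) := covering_simplicial_links universalp.1 linksS.
Let simplyX : simply_connected X := universalp.2.

(** One representative for each deck orbit of vertices. *)
Definition vertex_rep (w : S 0) : X 0 := xget o [set v | p 0 v = w].

Lemma vertex_repK w : p 0 (vertex_rep w) = w.
Proof.
rewrite /vertex_rep; case: xgetP => [//|H]; exfalso.
by have [v vw] := universalp.1.1 w; exact: H vw.
Qed.

(** Carries the orbit representative of a neighbour of [vertex_rep w] to that neighbour; such steps
    suffice to follow any edge path, as in [deck_orbit]. *)
Definition step_generator w s : aut X := xget 1%g [set g : aut X | deck p g /\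
  exists e, [/\ start e = vertex_rep w, l e = s
    & g 0 (vertex_rep (p 0 (finish e))) = finish e]].

(** Needed because the orbit of [o] under all automorphisms may meet several deck orbits. *)
Definition transfer_generator w : aut X := xget 1%g [set g : aut X | g 0 o = vertex_rep w].

Definition start_generator (sigma : {ffun Sigma0 -> Sigma0}) : aut X :=
  xget 1%g [set g : aut X | g 0 o = o /\ forall e, start e = o -> l (g 1 e) = sigma (l e)].

Definition portrait_generator w (A : {set Sigma0})
    (sigma : {ffun Sigma0 -> Sigma0}) : aut X :=
  xget 1%g [set g : aut X | realizes l (vertex_rep w) A sigma g].

Definition generators : seq (aut X) :=
  [seq step_generator w s | w <- vertS, s <- enum Sigma0] ++
  map transfer_generator vertS ++
  map start_generator (enum {: {ffun Sigma0 -> Sigma0}}) ++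
  [seq portrait_generator w a.1 a.2 |
     w <- vertS, a <- enum {: {set Sigma0} * {ffun Sigma0 -> Sigma0}}].

Definition dense_subgroup : set (aut X) := smallest (@subgroup (aut X)) [set` generators].

Notation H := dense_subgroup.

Lemma dense_subgroup_subgroup : subgroup H.
Proof. exact: smallest_subgroup. Qed.

Lemma generator_dense g : g \in generators -> H g.
Proof. by move=> gA M [_]; apply. Qed.

Lemma step_generatorP e : start e = vertex_rep (p 0 (start e)) ->
  let g := step_generator (p 0 (start e)) (l e) in
  [/\ H g, deck p g & g 0 (vertex_rep (p 0 (finish e))) = finish e].
Proof.
move=> se g; have Hg : H g.
  apply: generator_dense; rewrite mem_cat; apply/orP; left; apply/allpairsP.
  by exists (p 0 (start e), l e); rewrite mem_enum vertSP.
suff [dg [f [sf lf gf]]] : deck p g /\ exists f, [/\ start f = vertex_rep (p 0 (start e)),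
    l f = l e & g 0 (vertex_rep (p 0 (finish f))) = finish f].
  have fe : f = e by apply: (label_inj adml) lf; rewrite sf -se.
  by rewrite fe in gf.
rewrite /g /step_generator; case: xgetP => [//|] nog; exfalso.
have [h dh hf] := deck_transitive universalp.1 simplyX (vertex_repK (p 0 (finish e))).
by apply: (nog h); split => //; exists e.
Qed.

Lemma transfer_generatorP w : (exists g : aut X, g 0 o = vertex_rep w) ->
  H (transfer_generator w) /\ transfer_generator w 0 o = vertex_rep w.
Proof.
move=> [g gw]; split.
  by apply: generator_dense; rewrite !mem_cat map_f ?orbT.
by rewrite /transfer_generator; case: xgetP => [//|/(_ g)].
Qed.

Lemma dense_subgroup_start (k : aut X) : k 0 o = o ->
  exists h, [/\ H h, h 0 o = o & forall e, start e = o -> h 1 e = k 1 e].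
Proof.
move=> ko; pose sigma := [ffun s => local_action l k o s]; exists (start_generator sigma).
have sk e : start e = o -> l (k 1 e) = sigma (l e).
  by move=> eo; rewrite ffunE -eo (local_actionE adml).
have [ho hs] : start_generator sigma 0 o = o /\
    forall e, start e = o -> l (start_generator sigma 1 e) = sigma (l e).
  by rewrite /start_generator; case: xgetP => [//|/(_ k)]; case.
split=> // [|e eo]; last first.
  by apply: (label_inj adml); rewrite ?hs ?sk // -!cmap_start eo ho ko.
apply: generator_dense; rewrite !mem_cat; apply/orP; right; apply/orP; right.
by rewrite map_f ?mem_enum.
Qed.

(** Follow a path to [v]. If [g] carries a representative to the current vertex, the next edge
    pulled back by [g] starts at that representative, and its step generator is multiplied to [g] on
    the right. *)
Lemma deck_orbit v : exists g, [/\ H g, deck p g & g 0 (vertex_rep (p 0 v)) = v].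
Proof.
have HG := dense_subgroup_subgroup.
have [q] := simplyX.1 (vertex_rep (p 0 o)) v.
have : exists g, [/\ H g, deck p g &
    g 0 (vertex_rep (p 0 (vertex_rep (p 0 o)))) = vertex_rep (p 0 o)].
  by exists 1%g; rewrite vertex_repK; split => //; exact: subgroup1.
elim: q (vertex_rep (p 0 o)) => [|e q IH] a ga /=; first by move=> <-.
move=> [ea]; apply: IH; have [g [Hg dg ag]] := ga.
pose f := (g^-1)%g 1 e.
have gf : g 1 f = e by rewrite /f aut_invKV.
have pf : p 1 f = p 1 e by rewrite -gf dg.
have sf : start f = vertex_rep (p 0 (start f)).
  by rewrite [in RHS]cmap_start pf -[in RHS]cmap_start ea /f -cmap_start ea -{1}ag aut_invK.
have [Ht dt tf] := step_generatorP sf.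
set t := step_generator _ _ in Ht dt tf.
exists (g * t)%g; split; first exact: (subgroupM HG Hg Ht).
  by move=> n c; rewrite aut_mulE dg dt.
by rewrite cmap_finish -pf -cmap_finish aut_mulE tf cmap_finish gf.
Qed.

(** Deck transformations preserve labels, so conjugation moves the problem to [vertex_rep (p 0 v)]
    while [A] and [sigma] stay the same; this leaves finitely many cases. *)
Lemma dense_subgroup_realizes v sigma :
  (exists g, realizes l v (descending_labels l o v) sigma g) ->
  exists2 g, H g & realizes l v (descending_labels l o v) sigma g.
Proof.
move=> [g gv]; set A := descending_labels l o v in gv *.
have HG := dense_subgroup_subgroup.
have [c [Hc dc cv]] := deck_orbit v.
have lc e : l (c 1 e) = l e by exact: invl dc e.
have lcV e : l ((c^-1)%g 1 e) = l e by rewrite -[in RHS](aut_invKV c e) lc.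
set w := p 0 v in cv; pose fsigma := [ffun s => sigma s].
pose h := portrait_generator w A fsigma.
have hr : realizes l (vertex_rep w) A fsigma h.
  rewrite /h /portrait_generator; case: xgetP => [//|nog]; exfalso.
  apply: (nog (c^-1 * g * c)%g).
  have cvV : (c^-1)%g 0 v = vertex_rep w by rewrite -[in LHS]cv aut_invK.
  have := realizes_conj lcV gv; rewrite invgK cvV.
  by case=> [gw gs gA]; split => // e ew; rewrite ffunE gs.
exists (c * h * c^-1)%g.
  apply: (subgroupM HG); last exact: (subgroupV HG Hc).
  apply: (subgroupM HG Hc); apply: generator_dense.
  rewrite !mem_cat; do 3!(apply/orP; right).
  by apply/allpairsP; exists (w, (A, fsigma)); rewrite mem_enum vertSP.
have := realizes_conj lc hr; rewrite cv => -[ho hs hA]; split => // e ev.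
by rewrite hs // ffunE.
Qed.

Hypothesis app : forall (u : seq {set Sigma0}) (v : X 0),
  spells l o u v -> reduced_word l o u -> u <> [::] ->
  forall sigma : Sigma0 -> Sigma0,
    label_morphism l v sigma -> compatible l o u v sigma -> appears l o v sigma.

Lemma dense_subgroup_approx (g : aut X) (L : seq (X 0)) : exists2 h, H h &
  forall n b (c : X n), cvert b c \in L -> h n c = g n c.
Proof.
have HG := dense_subgroup_subgroup.
have [c [Hc dc cg]] := deck_orbit (g 0 o); set w := p 0 (g 0 o) in cg.
have [|Ht to] := @transfer_generatorP w.
  by exists (c^-1 * g)%g; rewrite aut_mulE -cg aut_invK.
set t := transfer_generator w in Ht to.
(* The product [c * t] sends [o] to [g 0 o], which reduces the approximation to the stabilizer of
   [o]. *)
pose k : aut X := ((c * t)^-1 * g)%g.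
have ct : (c * t)%g 0 o = g 0 o by rewrite aut_mulE to.
have ko : k 0 o = o by rewrite aut_mulE -ct aut_invK.
have [n Ln] : exists n, forall v, v \in L -> path_ball o n v.
  elim: L => [|v L [n Ln]]; first by exists 0.
  have [q qo] := simplyX.1 v o; exists (maxn n (size q)) => u.
  rewrite inE => /orP[/eqP ->|/Ln un].
    by exists q => //; exact: leq_maxr.
  by apply: ball_le un; exact: leq_maxl.
(* Radius [n + 1] also controls the neighbours of the vertices of [L]. *)
have [h Hh hk] := stabilizer_approx linksX simplyX adml app (subgroup1 HG)
  (fun x y => @subgroupM _ _ x y HG) dense_subgroup_start dense_subgroup_realizes n.+1 ko.
pose h' : aut X := (c * t * h)%g; exists h'.
  exact: (subgroupM HG (subgroupM HG Hc Ht) Hh).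
have h'g v : path_ball o n.+1 v -> h' 0 v = g 0 v.
  by move=> vn; rewrite aut_mulE hk // [k _ _]aut_mulE aut_invKV.
(* After reflecting, the given vertex is the start of the cube. The cube is determined by its corner
   edges, and these by their endpoints, where [h'] and [g] agree. *)
move=> m b d dL; rewrite -(reflectK b d).
have sd : start (restr (reflface b) d) = cvert b d by rewrite start_restr.
move: (restr (reflface b) d) sd => d' sd; rewrite !cmap_restr; congr restr.
have sn : path_ball o n (start d') by rewrite sd; exact: Ln.
have sh : start (h' m d') = start (g m d').
  by rewrite -!cmap_start h'g //; exact: ball_le sn.
apply: linksX.2 => // i; rewrite /corner -!cmap_cedge.
apply: (edge_rigid linksX simplyX adml).
  by rewrite -!cmap_start start_cedge h'g //; exact: ball_le sn.
rewrite -!cmap_finish h'g //; apply: ball_adjacent.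
by rewrite start_cedge.
Qed.

End Generators.

Theorem theorem2 (R : realType) (S X : cubeComplex) (p : cubeMap X S)
    (Sigma0 : finType) (inv : Sigma0 -> Sigma0) (l : X 1 -> Sigma0) (o : X 0) :
  compact [set: realization R S] ->
  connected [set: realization R S] ->
  nonpositively_curved S ->
  special S ->
  universal_covering p ->
  admissible inv l ->
  invariant_labeling (deck p) l ->
  (forall (u : seq {set Sigma0}) (v : X 0),
     spells l o u v -> reduced_word l o u -> u <> [::] ->
     forall sigma : Sigma0 -> Sigma0,
       label_morphism l v sigma -> compatible l o u v sigma ->
       appears l o v sigma) ->
  exists H : set (aut X),
    [/\ subgroup H, finitely_generated H & dense (H : set (aut_top R X))].
Proof.
move=> /compact_finite_vertices[vertS vertSP] _ [linksS _] _ univp adml invl app.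
exists (dense_subgroup p l o vertS); split.
- exact: dense_subgroup_subgroup.
- by exists [set` generators p l o vertS]; first exact: finite_seq.
- apply: dense_aut_top => g L.
  exact: (dense_subgroup_approx linksS univp adml invl vertSP app).
Qed.
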